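(* Let $I\subsetneqq R$ be a saturated strongly stable ideal with Hilbert polynomial $p(z)$ of degree $d$ (that is, $p$ is the Hilbert polynomial of $R/I$). Then there is a finite sequence of expansions (in the appropriate rings) that takes the ideal $(1)=R^{(d)}$ to the ideal $I\subset R$. In particular, for $j=0,\ldots,d$, the number of expansions needed in $R^{(j)}$ to take $I^{(j+1)}\cdot R^{(j)}$ to $I^{(j)}$ is $\Delta^{j}p(z)-p_{R^{(j)}/I^{(j+1)}R^{(j)}}(z)$, which is at most $a_j$. The total number of expansions needed to take $(1)=R^{(d)}$ to the ideal $I\subset R$ is at most $b_0$.
   Context: $K$ is an arbitrary field, $n\ge 2$, $R=K[x_0,\ldots,x_n]$, and $R^{(j)}=K[x_0,\ldots,x_{n-j}]$ (so $R^{(0)}=R$). $p_A$ denotes the Hilbert polynomial of a standard graded $K$-algebra $A$. A monomial ideal $I$ of a polynomial ring $K[x_0,\ldots,x_m]$ is strongly stable if for every monomial $x^A\in I$ and every $x_j\mid x^A$ we have $\frac{x_i}{x_j}x^A\in I$ whenever $0\le i<j$. A strongly stable ideal of $K[x_0,\ldots,x_m]$ is saturated iff no minimal monomial generator is divisible by $x_m$. $G(I)$ denotes the set of minimal monomial generators of $I$. For a monomial $x^A\ne1$, $\max(x^A)=\max\{i: x_i\mid x^A\}$. Expansion in $S=K[x_0,\ldots,x_m]$: for a monomial $x^A$ of positive degree put $\mathrm{Right}(x^A)=\{x^A\frac{x_{i+1}}{x_i}: x_i\mid x^A,\ 0\le i<m-1\}$. If $I\subsetneqq S$ is a saturated strongly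 stable ideal and $x^A\neq 1$ lies in $G(I)$ with $G(I)\cap \mathrm{Right}(x^A)=\varnothing$, then $x^A$ is called expandable in $I$, and the expansion of $x^A$ in $I$ is the ideal generated by $(G(I)\setminus\{x^A\})\cup\{x^A x_r,x^Ax_{r+1},\ldots,x^Ax_{m-1}\}$, where $r=\max(x^A)$. If $I=S$ and $x^A=1$, the expansion of $1$ in $S$ is the ideal $(x_0,\ldots,x_{m-1})$ (the zero ideal if $m=0$). A sequence of expansions in the appropriate rings means: one starts with the ideal $(1)=R^{(d)}$, performs expansions in $R^{(d)}$, passes to the extension ideal in $R^{(d-1)}$, performs expansions there, and so on, down to $R^{(0)}=R$. For a saturated strongly stable ideal $I\subset R$ with Hilbert polynomial of degree $d$ and $0\le j\le d$, $I^{(j)}\subset R^{(j)}$ is the ideal generated by the monomials obtained by setting $x_{n-j}=\cdots=x_{n-1}=1$ in the minimal monomial generators of $I$ (so $I^{(0)}=I$). For $j=d$, $I^{(d+1)}\cdot R^{(d)}$ stands for the starting ideal $(1)=R^{(d)}$. $\Delta^0p(z)=p(z)$ and $\Delta^jp(z)=\Delta^{j-1}p(z)-\Delta^{j-1}p(z-1)$ for $1\le j\le d$. The Hilbert polynomial $p$ of degree $d$ can be written uniquely as $p(z)=\sum_{i=0}^{d}\left[\binom{z+i}{i+1}-\binom{z+i-b_i}{i+1}\right]$ with integers $b_0\ge b_1\ge\cdots\ge b_d>0$; put $a_d=b_d$ and $a_i=b_i-b_{i+1}$ for $0\le i<d$. *)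

(* Defs.v *)
From HB Require Import structures.
From mathcomp Require Import all_boot all_order all_algebra.
From mathcomp Require Import mpoly.

Set Implicit Arguments.
Unset Strict Implicit.
Unset Printing Implicit Defensive.

Import Order.TTheory GRing.Theory Num.Theory.
Local Open Scope ring_scope.

(* Throughout, the ring K[x_0, ..., x_m] is {mpoly K[m.+1]}: the index m is that
   of the last variable, so R^(j) = K[x_0, ..., x_(n-j)] has index n - j. *)

(* Ideals are represented by their membership predicates, compared pointwise. *)
Definition pset (K : fieldType) (m : nat) := {mpoly K[m.+1]} -> Prop.

Definition pset_eq (K : fieldType) (m : nat) (I J : pset K m) : Prop :=
  forall f, I f <-> J f.

Definition whole (K : fieldType) (m : nat) : pset K m := fun=> True.
Arguments whole K m f : clear implicits.

Definition ideal_gen (K : fieldType) (m : nat) (S : pset K m) : pset K m :=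
  fun f => exists s : seq ({mpoly K[m.+1]} * {mpoly K[m.+1]}),
    (forall x, x \in s -> S x.2) /\ f = \sum_(x <- s) x.1 * x.2.

Definition mon_gen (K : fieldType) (m : nat) (S : 'X_{1..m.+1} -> Prop) :
    pset K m :=
  ideal_gen (fun f => exists2 a, S a & f = 'X_[a]).

Definition monomial_ideal (K : fieldType) (m : nat) (I : pset K m) : Prop :=
  exists S : 'X_{1..m.+1} -> Prop, pset_eq I (mon_gen S).

Definition proper_pset (K : fieldType) (m : nat) (I : pset K m) : Prop :=
  ~ pset_eq I (whole K m).

Definition strongly_stable (K : fieldType) (m : nat) (I : pset K m) : Prop :=
  monomial_ideal I /\
  forall (a : 'X_{1..m.+1}) (i j : 'I_m.+1), I 'X_[a] ->
    (0 < a j)%N -> (i < j)%N -> I 'X_[(a - U_(j) + U_(i))%MM].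

(* I : (x_0, ..., x_m)^oo is contained in I; the power (x_0, ..., x_m)^k is
   generated by the monomials of degree k. *)
Definition saturated (K : fieldType) (m : nat) (I : pset K m) : Prop :=
  forall f, (exists k : nat,
    forall u : 'X_{1..m.+1}, mdeg u = k -> I ('X_[u] * f)) -> I f.

(* a is (the exponent vector of) a minimal monomial generator of the monomial
   ideal I. *)
Definition min_gen (K : fieldType) (m : nat) (I : pset K m)
    (a : 'X_{1..m.+1}) : Prop :=
  I 'X_[a] /\ forall b : 'X_{1..m.+1}, (b <= a)%MM -> I 'X_[b] -> b = a.

(* h = dim_K (S/I)_t = dim_K S_t - dim_K I_t, where S = K[x_0, ..., x_m]. *)
Definition hilbert_fun (K : fieldType) (m : nat) (I : pset K m) (t h : nat) :
    Prop :=
  exists U : {vspace dhomog m.+1 K t},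
    (forall f : dhomog m.+1 K t, f \in U <-> I f) /\
    (\dim U + h)%N = \dim {: dhomog m.+1 K t}.

(* p is the Hilbert polynomial of the quotient K[x_0, ..., x_m] / I. *)
Definition hilbert_poly (K : fieldType) (m : nat) (I : pset K m)
    (p : {poly rat}) : Prop :=
  exists t0 : nat, forall t : nat, (t0 <= t)%N ->
    exists2 h : nat, hilbert_fun I t h & p.[t%:R] = h%:R.

Definition max_index (m : nat) (a : 'X_{1..m.+1}) : nat :=
  \max_(i < m.+1 | (0 < a i)%N) i.

Definition in_right (m : nat) (a c : 'X_{1..m.+1}) : Prop :=
  exists i j : 'I_m.+1,
    [/\ (0 < a i)%N, (i.+1 < m)%N, j = i.+1 :> nat
      & c = (a - U_(i) + U_(j))%MM].

Definition expandable (K : fieldType) (m : nat) (I : pset K m)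
    (a : 'X_{1..m.+1}) : Prop :=
  [/\ a <> 0%MM, min_gen I a & forall c, in_right a c -> ~ min_gen I c].

Definition expand (K : fieldType) (m : nat) (I : pset K m)
    (a : 'X_{1..m.+1}) : pset K m :=
  mon_gen (fun b => (min_gen I b /\ b <> a) \/
    exists k : 'I_m.+1, (max_index a <= k < m)%N /\ b = (a + U_(k))%MM).

Definition expansion (K : fieldType) (m : nat) (I J : pset K m) : Prop :=
  [/\ strongly_stable I, saturated I, proper_pset I
    & exists2 a, expandable I a & pset_eq J (expand I a)]
  \/ (pset_eq I (whole K m) /\
      pset_eq J (mon_gen (fun b => exists2 k : 'I_m.+1,
                                       (k < m)%N & b = U_(k)%MM))).

(* k expansions in K[x_0, ..., x_m] take I to J. *)
Inductive expansions (K : fieldType) (m : nat) (I : pset K m) :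
    nat -> pset K m -> Prop :=
| Expansions0 J : pset_eq J I -> expansions I 0 J
| ExpansionsS k J L : expansions I k J -> expansion J L -> expansions I k.+1 L.

(* The inclusion K[x_0, ..., x_m] -> K[x_0, ..., x_m']; meant for m <= m'. *)
Definition incl (K : fieldType) (m m' : nat) (f : {mpoly K[m.+1]}) :
    {mpoly K[m'.+1]} :=
  f \mPo [tuple 'X_(inord i : 'I_m'.+1) | i < m.+1].
Arguments incl {K m} m' f.

Definition extension (K : fieldType) (m m' : nat) (I : pset K m) : pset K m' :=
  ideal_gen (fun g => exists2 f, I f & g = incl m' f).
Arguments extension {K m} m' I g.

(* A sequence of k expansions in K[x_0, ..., x_m0], ..., K[x_0, ..., x_m]
   successively, which takes the ideal (1) of K[x_0, ..., x_m0] to I in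
   K[x_0, ..., x_m]. *)
Inductive expansion_seq (K : fieldType) (m0 : nat) :
    forall m : nat, nat -> pset K m -> Prop :=
| ExpSeqStart (I : pset K m0) :
    pset_eq I (whole K m0) -> expansion_seq m0 0 I
| ExpSeqExpand m k (I J : pset K m) :
    expansion_seq m0 k I -> expansion I J -> expansion_seq m0 k.+1 J
| ExpSeqExtend m k (I : pset K m) (J : pset K m.+1) :
    expansion_seq m0 k I -> pset_eq J (extension m.+1 I) ->
    expansion_seq m0 k J.

(* The exponent vector of x^a after setting x_m = ... = x_(n-1) = 1. *)
Definition set_one (m n : nat) (a : 'X_{1..n.+1}) : 'X_{1..n.+1} :=
  [multinom if (m <= i < n)%N then 0%N else a i | i < n.+1].

(* I^(n-m) as an ideal of R^(n-m) = K[x_0, ..., x_m]: a generator g is a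
   polynomial of R^(n-m) which, as an element of R, is the monomial obtained
   from a minimal generator of I. *)
Definition descent (K : fieldType) (n m : nat) (I : pset K n) : pset K m :=
  ideal_gen (fun g =>
    exists2 a, min_gen I a & incl n g = 'X_[set_one m a]).
Arguments descent {K n} m I g.

(* I^(j+1) R^(j), with the convention that it is (1) for j = d. *)
Definition descent_ext (K : fieldType) (n d j : nat) (I : pset K n) :
    pset K (n - j) :=
  if j == d then whole K (n - j)
  else extension (n - j) (descent (n - j.+1) I).
Arguments descent_ext {K n} d j I g.

Definition bdiff (p : {poly rat}) : {poly rat} := p - (p \Po ('X - 1)).

Definition binom_poly (q : {poly rat}) (k : nat) : {poly rat} :=
  (k`!%:R)^-1 *: \prod_(l < k) (q - l%:R%:P).

Definition gotzmann_rep (d : nat) (b : nat -> int) (p : {poly rat}) : Prop :=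
  [/\ forall i : nat, (i < d)%N -> b i.+1 <= b i,
      0 < b d
    & p = \sum_(i < d.+1)
            (binom_poly ('X + (i%:R)%:P) i.+1
             - binom_poly ('X + ((i%:Z - b i)%:~R)%:P) i.+1)].

Definition gotzmann_a (d : nat) (b : nat -> int) (i : nat) : int :=
  if i == d then b d else b i - b i.+1.

(* Main.v *)
Require Import Defs.
From Stdlib Require Import ClassicalEpsilon FunctionalExtensionality PropExtensionality.
From HB Require Import structures.
From mathcomp Require Import all_boot all_order all_algebra.
From mathcomp Require Import mpoly zify ring.

Set Implicit Arguments.
Unset Strict Implicit.
Unset Printing Implicit Defensive.

Import Order.TTheory GRing.Theory Num.Theory.
Local Open Scope ring_scope.

(** Write psi_k(a) = a_0 + ... + a_(k-1). The saturated strongly stable ideals of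
    K[x_0, ..., x_m] are the monomial ideals whose sets of exponents are closed
    upwards for the dominance preorder "psi_k(a) <= psi_k(b) for all k <= m", and
    the expandable monomials of such an ideal are the minimal elements of its set
    of exponents. The expansion of x^A just removes the monomials x^A x_m^i, so it
    preserves closure under dominance and adds 1 to the Hilbert polynomial. Since
    I^(j) and I^(j+1) R^(j) differ by finitely many such classes (Dickson), one
    passes from the larger to the smaller by removing, one after the other,
    dominance-minimal elements of the difference.

    For the bounds, along a sequence of expansions one keeps numbers
    b_0 >= ... >= b_e such that the Hilbert function h of the current quotient
    satisfies h >= L_b everywhere and h(t) = L_b(t) for t >= b_0 - 1, where L_b is
    the Hilbert function of the lexicographic ideal with Gotzmann numbers b. After k
    expansions the generators have degree at most k <= b_0, so one more expansion
    amounts to b_0 := b_0 + 1; an extension to the next ring replaces h by its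
    partial sums and b by (b_0 + c, b_0, ..., b_e), where c >= 0 is the total excess
    of h over L_b. Gotzmann representations being unique, these are the b_i of the
    theorem. *)

Local Open Scope nat_scope.

(** Excluded middle turns existence statements into booleans, so that sets of exponents can be
    boolean predicates and their elements can be counted. *)
Definition dec (P : Prop) : bool :=
  if excluded_middle_informative P then true else false.

Lemma decP (P : Prop) : reflect P (dec P).
Proof. by rewrite /dec; case: excluded_middle_informative => h; constructor. Qed.

(** * Exponent vectors and the dominance order *)

(* Coordinates are indexed by nat, so that exponent vectors of different
   polynomial rings can be compared. *)
Definition coord (m : nat) (a : 'X_{1..m}) (i : nat) : nat := nth 0 a i.

Definition psum (m : nat) (a : 'X_{1..m}) (k : nat) : nat :=
  \sum_(i < k) coord a i.

Definition monom (m : nat) (f : nat -> nat) : 'X_{1..m} :=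
  [multinom f i | i < m].

Lemma coord_ord m (a : 'X_{1..m}) (i : 'I_m) : coord a i = a i.
Proof. by rewrite (mnm_nth 0). Qed.

Lemma coord_out m (a : 'X_{1..m}) i : m <= i -> coord a i = 0.
Proof. by move=> h; rewrite /coord nth_default // size_tuple. Qed.

Lemma coord_inj m (a b : 'X_{1..m}) :
  (forall i, i < m -> coord a i = coord b i) -> a = b.
Proof. by move=> h; apply/mnmP => i; rewrite -!coord_ord h. Qed.

Lemma coord_monom m f i : coord (monom m f) i = if i < m then f i else 0.
Proof.
case: ltnP => h; last exact: coord_out.
by rewrite -[i]/(nat_of_ord (Ordinal h)) coord_ord mnmE.
Qed.

Lemma lem_coordP m (a b : 'X_{1..m}) :
  reflect (forall i, coord a i <= coord b i) (a <= b)%MM.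
Proof.
apply: (iffP mnm_lepP) => h i; last by rewrite -!coord_ord.
have [hi|hi] := ltnP i m; last by rewrite !coord_out.
by rewrite -[i]/(nat_of_ord (Ordinal hi)) !coord_ord.
Qed.

Lemma coordD m (a b : 'X_{1..m}) i :
  coord (a + b)%MM i = coord a i + coord b i.
Proof.
have [hi|hi] := ltnP i m; last by rewrite !coord_out.
by rewrite -[i]/(nat_of_ord (Ordinal hi)) !coord_ord mnmDE.
Qed.

Lemma coordB m (a b : 'X_{1..m}) i :
  coord (a - b)%MM i = coord a i - coord b i.
Proof.
have [hi|hi] := ltnP i m; last by rewrite !coord_out.
by rewrite -[i]/(nat_of_ord (Ordinal hi)) !coord_ord mnmBE.
Qed.

Lemma coordU m (j : 'I_m) i : coord U_(j)%MM i = (i == j).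
Proof.
have [hi|hi] := ltnP i m.
  by rewrite -[i]/(nat_of_ord (Ordinal hi)) coord_ord mnm1E eq_sym.
by rewrite coord_out //; case: eqP => // e; move: (ltn_ord j); rewrite -e ltnNge hi.
Qed.

Lemma coordUn m (j : 'I_m) k i : coord (U_(j) *+ k)%MM i = (i == j) * k.
Proof.
have [hi|hi] := ltnP i m.
  by rewrite -[i]/(nat_of_ord (Ordinal hi)) coord_ord mulmnE mnm1E eq_sym.
rewrite coord_out //; case: eqP => // e.
by move: (ltn_ord j); rewrite -e ltnNge hi.
Qed.

Lemma coord0 m i : coord (0%MM : 'X_{1..m}) i = 0.
Proof.
have [hi|hi] := ltnP i m; last by rewrite !coord_out.
by rewrite -[i]/(nat_of_ord (Ordinal hi)) !coord_ord mnm0E.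
Qed.

Lemma psum0 m (a : 'X_{1..m}) : psum a 0 = 0.
Proof. exact: big_ord0. Qed.

Lemma psumS m (a : 'X_{1..m}) k : psum a k.+1 = psum a k + coord a k.
Proof. exact: big_ord_recr. Qed.

Lemma psum_mdeg m (a : 'X_{1..m}) : mdeg a = psum a m.
Proof. by rewrite mdegE; apply: eq_bigr => i _; rewrite coord_ord. Qed.

Lemma psum_le m (a : 'X_{1..m}) k l : k <= l -> psum a k <= psum a l.
Proof.
move=> /subnK <-; elim: (l - k) => [|d IH] //=.
by rewrite addSn psumS (leq_trans IH) ?leq_addr.
Qed.

Lemma leq_psum m m' (a : 'X_{1..m}) (b : 'X_{1..m'}) k :
  (forall i, i < k -> coord a i <= coord b i) -> psum a k <= psum b k.
Proof. by move=> h; apply: leq_sum => i _; apply: h. Qed.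

Lemma eq_psum m m' (a : 'X_{1..m}) (b : 'X_{1..m'}) k :
  (forall i, i < k -> coord a i = coord b i) -> psum a k = psum b k.
Proof. by move=> h; apply: eq_bigr => i _; apply: h. Qed.

Lemma psumD m (a b : 'X_{1..m}) k : psum (a + b)%MM k = psum a k + psum b k.
Proof.
by rewrite /psum -big_split /=; apply: eq_bigr => i _; rewrite coordD.
Qed.

Lemma psumUn m (j : 'I_m) d k : psum (U_(j) *+ d)%MM k = (j < k) * d.
Proof.
elim: k => [|k IH]; first by rewrite psum0.
rewrite psumS IH coordUn -mulnDl; congr (_ * _).
by rewrite ltnS; case: ltngtP.
Qed.

Lemma psumU m (j : 'I_m) k : psum U_(j)%MM k = (j < k).
Proof. by rewrite -[U_(j)%MM]mulm1n psumUn muln1. Qed.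

(** The vectors may have different lengths, so that exponents of different rings can be compared.
    Coordinates from index [r] on are ignored; with [r = m] the exponent of [x_m] does not matter,
    which encodes saturation. *)
Definition dominated (r m m' : nat) (a : 'X_{1..m}) (b : 'X_{1..m'}) : Prop :=
  forall k, k <= r -> psum a k <= psum b k.

Lemma dominated_lem r m (a b : 'X_{1..m}) : (a <= b)%MM -> dominated r a b.
Proof. by move=> /lem_coordP h k _; apply: leq_psum. Qed.

Lemma dominated_trans r m1 m2 m3 (a : 'X_{1..m1}) (b : 'X_{1..m2})
    (c : 'X_{1..m3}) : dominated r a b -> dominated r b c -> dominated r a c.
Proof. by move=> h1 h2 k hk; apply: leq_trans (h1 k hk) (h2 k hk). Qed.

Lemma eq_psum_coord r m m' (a : 'X_{1..m}) (b : 'X_{1..m'}) :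
  (forall k, k <= r -> psum a k = psum b k) ->
  forall i, i < r -> coord a i = coord b i.
Proof.
move=> h i hi; have := h i.+1 hi.
by rewrite !psumS h 1?ltnW // => /addnI.
Qed.

(* The sets of exponents of the saturated strongly stable ideals of
   K[x_0, ..., x_m]. *)
Definition borel (m : nat) (P : pred 'X_{1..m.+1}) : Prop :=
  forall a b, P a -> dominated m a b -> P b.

Lemma borel_up m (P : pred 'X_{1..m.+1}) a b :
  borel P -> (a <= b)%MM -> P a -> P b.
Proof. by move=> hP h ha; apply: hP ha _; apply: dominated_lem. Qed.

Lemma psum_move m (a : 'X_{1..m}) (i j : 'I_m) k : 0 < a j -> i < j ->
  psum (a - U_(j) + U_(i))%MM k = psum a k + ((i < k) && (k <= j)).
Proof.
move=> aj ij; have h : (U_(j) <= a)%MM by rewrite lep1mP -lt0n.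
have e : psum a k = psum (a - U_(j))%MM k + (j < k).
  by rewrite -psumU -psumD submK.
rewrite psumD psumU e.
by case: (ltnP j k) => h1; case: (ltnP i k) => h2 /=; lia.
Qed.

(** One climbs from [a] upwards by raising a single partial sum by one at a time: replacing [x_j] by
    [x_(j-1)] raises only the one at [j], and a factor [x_m] raises only the total degree. *)
Lemma borel_of_stable m (P : pred 'X_{1..m.+1}) :
  (forall a b, (a <= b)%MM -> P a -> P b) ->
  (forall (a : 'X_{1..m.+1}) (i j : 'I_m.+1), P a -> 0 < a j -> i < j ->
     P (a - U_(j) + U_(i))%MM) ->
  (forall a, P (a + U_(ord_max))%MM -> P a) ->
  borel P.
Proof.
move=> up st sat a b Pa ab.
suff main c : dominated m.+1 a c -> P c.
  (* Padding by [x_m ^ mdeg a] makes the target dominate [a] in total degree as well; saturation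
     then strips the padding. *)
  have : P (b + U_(ord_max) *+ mdeg a)%MM.
    apply: main => k; rewrite psumD psumUn leq_eqVlt => /orP[/eqP ->|hk].
      by rewrite psum_mdeg /= ltnS leqnn mul1n leq_addl.
    by rewrite (leq_trans (ab k _)) ?leq_addr.
  elim: (mdeg a) => [|d IH]; first by rewrite mulm0n addm0.
  by rewrite mulmSr addmA => /sat.
move: Pa; clear ab b.
have [N] := ubnP (\sum_(k < m.+2) (psum c k - psum a k)).
elim: N a => // N IH a lN Pa ac.
case: (boolP [forall k : 'I_m.+2, psum c k <= psum a k]) => [/forallP h|].
  suff <- : a = c by [].
  apply: coord_inj; apply: eq_psum_coord => k hk; apply/eqP.
  by rewrite eqn_leq ac //=; apply: (h (Ordinal (hk : k < m.+2))).
rewrite negb_forall => /existsP[k0 hk0]; rewrite -ltnNge in hk0.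
have ex0 : exists k, (k <= m.+1) && (psum a k < psum c k).
  by exists k0; rewrite -ltnS ltn_ord.
have ub0 k : (k <= m.+1) && (psum a k < psum c k) -> k <= m.+1 by case/andP.
(* Since [j] is the largest deficient index, there is no deficit at [j.+1] when [j <= m]; this
   forces [a_j > 0], so that the move at [j] is available. *)
case: (ex_maxnP ex0 ub0) => j /andP[jm lj] maxj.
have step a' : P a' ->
    (forall k, k <= m.+1 -> psum a' k = psum a k + (k == j)) -> P c.
  move=> Pa' e; apply: (IH a') => // [|k hk]; last first.
    by rewrite e //; case: eqP => [->|_]; rewrite ?addn1 // addn0 ac.
  rewrite -ltnS (leq_trans _ lN) // ltnS.
  rewrite (bigD1 (Ordinal (jm : j < m.+2))) //=.
  rewrite [X in _ < X](bigD1 (Ordinal (jm : j < m.+2))) //=.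
  rewrite -addSn leq_add //; first by rewrite e // eqxx; lia.
  apply: leq_sum => k _; rewrite e ?leq_sub2l ?leq_addr //.
  by rewrite -ltnS ltn_ord.
move: jm; rewrite leq_eqVlt => /orP[/eqP ej|jm].
  apply: (step (a + U_(ord_max))%MM) => [|k hk].
    by apply: up Pa; apply: lem_addr.
  by rewrite psumD psumU /= ej [k == _]eqn_leq hk.
have aj : 0 < coord a j.
  have : psum c j.+1 <= psum a j.+1.
    rewrite leqNgt; apply/negP => h.
    by have := maxj j.+1; rewrite jm h ltnn => /(_ isT).
  by rewrite !psumS; lia.
have j0 : 0 < j by case: (j) lj => //; rewrite !psum0.
have hj : j.-1 < m.+1 by apply: leq_ltn_trans (leq_pred _) jm.
apply: (step (a - U_(Ordinal jm) + U_(Ordinal hj))%MM) => [|k hk].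
  by apply: st => //; [rewrite -coord_ord | rewrite /= prednK].
rewrite psum_move -?coord_ord //= ?prednK //.
by congr (_ + _); rewrite eqn_leq andbC.
Qed.

Lemma dominated_move m (a : 'X_{1..m.+1}) r (i j : 'I_m.+1) :
  0 < a j -> i < j -> dominated r a (a - U_(j) + U_(i))%MM.
Proof. by move=> aj ij k _; rewrite psum_move // leq_addr. Qed.

Lemma borel_stable m (P : pred 'X_{1..m.+1}) (a : 'X_{1..m.+1})
    (i j : 'I_m.+1) :
  borel P -> P a -> 0 < a j -> i < j -> P (a - U_(j) + U_(i))%MM.
Proof. by move=> hP Pa aj ij; apply: hP Pa _; apply: dominated_move. Qed.

Lemma borel_sat m (P : pred 'X_{1..m.+1}) a d :
  borel P -> P (a + U_(ord_max) *+ d)%MM -> P a.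
Proof.
move=> hP h; apply: hP h _ => k hk.
by rewrite psumD psumUn /= ltnNge hk addn0.
Qed.

Definition chop (m : nat) (a : 'X_{1..m.+1}) : 'X_{1..m.+1} :=
  monom m.+1 (fun i => if i < m then coord a i else 0).

Lemma psum_chop m (a : 'X_{1..m.+1}) k : k <= m -> psum (chop a) k = psum a k.
Proof.
move=> hk; apply: eq_psum => i hi.
have hm := leq_trans hi hk.
by rewrite coord_monom ltnS hm (ltnW hm).
Qed.

Lemma coord_chop m (a : 'X_{1..m.+1}) : coord (chop a) m = 0.
Proof. by rewrite coord_monom ltnSn ltnn. Qed.

Lemma chop_le m (a : 'X_{1..m.+1}) : (chop a <= a)%MM.
Proof. by apply/lem_coordP => i; rewrite coord_monom; case: ifP => //; case: ifP. Qed.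

Lemma borel_chop m (P : pred 'X_{1..m.+1}) a : borel P -> P (chop a) = P a.
Proof.
by move=> hP; apply/idP/idP => h; apply: hP h _ => k hk; rewrite psum_chop.
Qed.

(* The combinatorial form of expandability, see [expandable_dmin]. *)
Definition dmin (m : nat) (P : pred 'X_{1..m.+1}) (A : 'X_{1..m.+1}) : Prop :=
  [/\ P A, coord A m = 0
    & forall u, P u -> dominated m u A -> dominated m A u].

(** When [A] is free of [x_m], its class consists of the monomials [x^A x_m^i], those that the
    expansion of [x^A] deletes. *)
Definition same_class (m : nat) (A c : 'X_{1..m.+1}) : bool :=
  [forall i : 'I_m, coord A i == coord c i].

Lemma same_classP m (A c : 'X_{1..m.+1}) :
  reflect (forall i, i < m -> coord A i = coord c i) (same_class A c).
Proof.
apply: (iffP forallP) => h i; first by move=> hi; apply/eqP/(h (Ordinal hi)).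
by apply/eqP/h.
Qed.

Lemma same_class_dom m (A c : 'X_{1..m.+1}) :
  same_class A c <-> dominated m A c /\ dominated m c A.
Proof.
split=> [/same_classP h|[h1 h2]].
  by split=> k hk; rewrite (@eq_psum _ _ A c k) // => i hi; apply/h/leq_trans/hk.
apply/same_classP; apply: eq_psum_coord => k hk; apply/eqP.
by rewrite eqn_leq h1 ?h2.
Qed.

Lemma same_class_eq m (A c : 'X_{1..m.+1}) :
  same_class A c -> coord A m = coord c m -> A = c.
Proof.
move=> /same_classP h e; apply: coord_inj => i.
by rewrite ltnS leq_eqVlt => /orP[/eqP ->|/h].
Qed.

(** * Removing one class after the other *)

Definition removal (m : nat) (P : pred 'X_{1..m.+1}) (A : 'X_{1..m.+1}) :
    pred 'X_{1..m.+1} := fun c => P c && ~~ same_class A c.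

(** If [b] dominates [a] and lies in the class of [A], then [a] is dominated by [A], and minimality
    puts [a] in that class too. *)
Lemma borel_removal m (P : pred 'X_{1..m.+1}) A :
  borel P -> dmin P A -> borel (removal P A).
Proof.
move=> hP [PA _ minA] a b /andP[Pa nA] ab; rewrite /removal (hP a) //=.
apply: contra nA => /same_class_dom[h1 h2]; apply/same_class_dom.
by have aA := dominated_trans ab h2; split=> //; apply: minA.
Qed.

Lemma dmin_mdeg m (P : pred 'X_{1..m.+1}) A : dmin P A -> mdeg A = psum A m.
Proof. by case=> _ e _; rewrite psum_mdeg psumS e addn0. Qed.

(** An element of [E] outside [D] with the least sum of partial sums will do, once chopped: an
    element of [E] dominated by it is again outside [D], as [D] is closed, and a strict drop of one
    partial sum would lower the weight. *)
Lemma dmin_outside m (E D : pred 'X_{1..m.+1}) c :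
  borel E -> borel D -> E c -> ~~ D c -> exists2 A, dmin E A & ~~ D A.
Proof.
move=> bE bD Ec Dc.
pose w (a : 'X_{1..m.+1}) := \sum_(k < m.+1) psum a k.
pose good d := dec (exists a, [/\ E a, ~~ D a & w a = d]).
have ex0 : exists d, good d by exists (w c); apply/decP; exists c.
case: (ex_minnP ex0) => d /decP[a [Ea Da wa]] mind.
exists (chop a); last by rewrite borel_chop.
split; rewrite ?borel_chop // ?coord_chop // => u Eu ua k hk.
have ua' : dominated m u a.
  by move=> l hl; have := ua l hl; rewrite psum_chop.
have Du : ~~ D u by apply: contra Da => /bD; apply.
have : w a <= w u by rewrite wa; apply/mind/decP; exists u.
rewrite psum_chop // leqNgt => h; rewrite leqNgt.
apply: contra h => h; rewrite /w (bigD1 (Ordinal (hk : k < m.+1))) //=.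
rewrite [X in _ < X](bigD1 (Ordinal (hk : k < m.+1))) //= -addSn leq_add //.
by apply: leq_sum => l _; apply: ua'; rewrite -ltnS.
Qed.

Fixpoint removals (m : nat) (E : pred 'X_{1..m.+1}) (s : seq 'X_{1..m.+1})
    (D : pred 'X_{1..m.+1}) : Prop :=
  if s is A :: s' then dmin E A /\ removals (removal E A) s' D else E =1 D.

(** The last hypothesis leaves only finitely many classes in the difference: their representatives
    free of [x_m] have degree below [B]. Each removal takes away one of them. *)
Lemma removals_exist m (E D : pred 'X_{1..m.+1}) B :
  borel E -> borel D -> (forall c, D c -> E c) ->
  (forall c, E c -> B <= psum c m -> D c) ->
  exists s, removals E s D.
Proof.
move=> bE bD; pose S (E : pred 'X_{1..m.+1}) :=
  [set a : 'X_{1..m.+1 < B} | E a && ~~ D a && (coord a m == 0)].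
have [N] := ubnP #|S E|; elim: N E bE => // N IH E bE lN DE fin.
case: (excluded_middle_informative (exists c, E c && ~~ D c)); last first.
  move=> h; exists [::] => /= c; apply/idP/idP; last exact: DE.
  by move=> Ec; apply/negPn/negP => Dc; apply: h; exists c; rewrite Ec Dc.
case=> c /andP[Ec Dc]; have [A dA DA] := dmin_outside bE bD Ec Dc.
have [EA A0 minA] := dA.
have lA : mdeg A < B.
  by rewrite (dmin_mdeg dA) ltnNge; apply/negP => h; rewrite fin in DA.
case: (IH (removal E A)) => [|||c'|s hs]; last by exists (A :: s).
- exact: borel_removal.
- rewrite (leq_trans _ (lN : #|S E| <= N)) //; apply: proper_card.
  apply/properP; split; last first.
    exists (BMultinom lA); rewrite !inE /= ?EA ?DA ?A0 //=.
    by rewrite /removal (_ : same_class A A) ?andbF //; apply/same_classP.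
  apply/subsetP => a; rewrite !inE /removal.
  by case/andP => /andP[/andP[-> _] ->] ->.
- move=> c' Dc'; rewrite /removal DE //=; apply: contra DA => h.
  by apply: bD Dc' _; case/same_class_dom: h.
- by case/andP => Ec' _; apply: fin.
Qed.

(** In the inductive step, ignoring coordinate [k] yields generators on which that coordinate is at
    most [M]. These serve every [a] with [x a k >= M]; each of the finitely many slices with a fixed
    [x a k < M] is treated by induction. *)
Lemma dickson (T : Type) (x : T -> nat -> nat) (f : T -> nat) (P : T -> Prop)
    (k : nat) :
  exists B, forall a, P a ->
    exists g, [/\ P g, forall i, i < k -> x g i <= x a i & f g <= B].
Proof.
elim: k f P => [|k IH] f P.
  case: (excluded_middle_informative (exists a, P a)) => [[a Pa]|h].
    by exists (f a) => b _; exists a.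
  by exists 0 => a Pa; case: h; exists a.
have [M hM] := IH (fun g => maxn (f g) (x g k)) P.
have : exists B, forall a, P a -> x a k < M -> exists g,
    [/\ P g, forall i, i < k.+1 -> x g i <= x a i & f g <= B].
  elim: {hM} M => [|M [B hB]]; first by exists 0.
  have [B' hB'] := IH f (fun a => P a /\ x a k = M).
  exists (maxn B B') => a Pa; rewrite ltnS leq_eqVlt => /orP[/eqP e|h].
    have [g [[Pg eg] h1 h2]] := hB' a (conj Pa e).
    exists g; split => //; last by rewrite leq_max h2 orbT.
    by move=> i; rewrite ltnS leq_eqVlt => /orP[/eqP ->|/h1 //]; rewrite e eg.
  by have [g [h1 h2 h3]] := hB a Pa h; exists g; rewrite leq_max h3.
case=> B hB; exists (maxn B M) => a Pa.
have [h|h] := ltnP (x a k) M.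
  by have [g [h1 h2 h3]] := hB a Pa h; exists g; rewrite leq_max h3.
have [g [h1 h2]] := hM a Pa; rewrite geq_max => /andP[h3 h4].
exists g; split=> //; last by rewrite leq_max h3 orbT.
move=> i; rewrite ltnS leq_eqVlt => /orP[/eqP ->|/h2 //].
exact: leq_trans h4 h.
Qed.

(* For r = m (resp. r = m - 1) these are the exponents of the ideal I^(n-m)
   (resp. I^(n-m+1) R^(n-m)) of K[x_0, ..., x_m]. *)
Definition trace (n r m : nat) (P : pred 'X_{1..n.+1}) : pred 'X_{1..m.+1} :=
  fun c => dec (exists2 a, P a & dominated r a c).
Arguments trace {n} r m P c.

Lemma borel_trace n r m (P : pred 'X_{1..n.+1}) : r <= m -> borel (trace r m P).
Proof.
move=> rm a b /decP[c Pc ca] ab; apply/decP; exists c => //.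
by apply: dominated_trans ca _ => k hk; apply: ab; apply: leq_trans hk rm.
Qed.

Lemma trace_id n (P : pred 'X_{1..n.+1}) : borel P -> trace n n P =1 P.
Proof.
by move=> bP c; apply/decP/idP => [[a Pa /(bP _ _ Pa)]|Pc] //; exists c.
Qed.

(** Only the partial sum at [m] distinguishes the two traces. Dickson's lemma, applied to partial
    sums, provides elements of [P] of degree at most [B], and these pass the test at [m] once
    [psum c m] reaches [B]. *)
Lemma trace_finite n m (P : pred 'X_{1..n.+1}) :
  exists B, forall c, trace m.-1 m P c -> B <= psum c m -> trace m m P c.
Proof.
have [B hB] := dickson (@psum n.+1) (@mdeg n.+1) P m.
exists B => c /decP[a Pa ac] hc.
have [g [Pg ga dg]] := hB a Pa.
apply/decP; exists g => // k; rewrite leq_eqVlt => /orP[/eqP ->|hk]; last first.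
  by apply: leq_trans (ga k hk) (ac k _); case: (m) hk.
apply: leq_trans (leq_trans dg hc); rewrite psum_mdeg.
have [h|h] := leqP m n.+1; first exact: psum_le.
rewrite -(subnKC (ltnW h)); elim: (m - n.+1) => [|d IH]; rewrite ?addn0 //.
by rewrite addnS psumS [coord _ _]coord_out ?addn0 // leq_addr.
Qed.

Definition resize (m' m : nat) (c : 'X_{1..m.+1}) : 'X_{1..m'.+1} :=
  monom m'.+1 (coord c).
Arguments resize m' {m} c.

Lemma psum_resize m' m (c : 'X_{1..m.+1}) k :
  k <= m'.+1 -> psum (resize m' c) k = psum c k.
Proof.
by move=> h; apply: eq_psum => i hi; rewrite coord_monom (leq_trans hi).
Qed.

Lemma trace_resize n r m' m (P : pred 'X_{1..n.+1}) (c : 'X_{1..m.+1}) :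
  r <= m'.+1 -> trace r m' P (resize m' c) = trace r m P c.
Proof.
move=> h; apply/decP/decP => -[a Pa ac]; exists a => // k hk;
  by have := ac k hk; rewrite psum_resize // (leq_trans hk).
Qed.

(** * Hilbert functions of monomial ideals *)

Definition hilb (m : nat) (P : pred 'X_{1..m.+1}) (t : nat) : nat :=
  #|[set a : 'X_{1..m.+1 < t.+1} | (mdeg a == t) && ~~ P a]|.

Lemma eq_hilb m (P Q : pred 'X_{1..m.+1}) t : P =1 Q -> hilb P t = hilb Q t.
Proof.
by move=> h; rewrite /hilb; apply: eq_card => a; rewrite !inE h.
Qed.

Lemma hilb_predT m t : hilb (xpredT : pred 'X_{1..m.+1}) t = 0.
Proof. by apply: eq_card0 => a; rewrite !inE andbF. Qed.

(** The class of [A] has exactly one element in each degree [t >= mdeg A], namely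
    [x^A x_m^(t - mdeg A)], and none in smaller degrees. *)
Lemma hilb_removal m (P : pred 'X_{1..m.+1}) A t :
  borel P -> dmin P A -> hilb (removal P A) t = hilb P t + (mdeg A <= t).
Proof.
move=> bP dA; have [PA A0 _] := dA.
case: leqP => hA; last first.
  rewrite addn0; apply: eq_card => a; rewrite !inE; case: eqP => //= e.
  rewrite /removal negb_and negbK; case: (boolP (same_class A a)) => [|_].
    case/same_class_dom => /(_ _ (leqnn _)) h _.
    by move: e hA; rewrite psum_mdeg psumS (dmin_mdeg dA); lia.
  by rewrite orbF.
have ez : mdeg (A + U_(ord_max) *+ (t - mdeg A))%MM = t.
  by rewrite mdegD mdegMn mdeg1 mul1n subnKC.
have hz : mdeg (A + U_(ord_max) *+ (t - mdeg A))%MM < t.+1 by rewrite ez.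
have Pz : P (A + U_(ord_max) *+ (t - mdeg A))%MM.
  by apply: borel_up bP _ PA; apply: lem_addr.
have sz : same_class A (A + U_(ord_max) *+ (t - mdeg A))%MM.
  by apply/same_classP => i hi; rewrite coordD coordUn /= ltn_eqF // addn0.
rewrite addn1 /hilb; set S := [set a | _ & ~~ P _].
suff -> : [set a : 'X_{1..m.+1 < t.+1} | (mdeg a == t) && ~~ removal P A a]
    = BMultinom hz |: S.
  by rewrite cardsU1 !inE /= Pz andbF.
apply/setP => a; rewrite !inE -val_eqE /=.
case: (eqVneq (bmnm a) _) => [->|ne] /=.
  by rewrite ez eqxx /removal sz andbF.
case: eqP => //= e; rewrite /removal negb_and negbK.
case: (boolP (same_class A a)) => [h|_]; last by rewrite orbF.
case/negP: ne; apply/eqP/coord_inj => i; rewrite ltnS leq_eqVlt.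
case/orP => [/eqP ->|hi].
  have [h1 h2] := (same_class_dom A a).1 h.
  have := h1 m (leqnn _); have := h2 m (leqnn _); move: e.
  rewrite coordD A0 coordUn eqxx mul1n add0n psum_mdeg psumS (dmin_mdeg dA).
  lia.
by rewrite coordD coordUn ltn_eqF // addn0; apply/esym/(same_classP _ _ h).
Qed.

(** Membership ignores the new variable, so the monomials are sorted by the degree [s] of their part
    in the old variables; the new variable then has exponent [t - s]. *)
Lemma hilb_resize m (P : pred 'X_{1..m.+1}) t :
  hilb (fun c : 'X_{1..m.+2} => P (resize m c)) t = \sum_(s < t.+1) hilb P s.
Proof.
pose S := [set a : 'X_{1..m.+2 < t.+1} | (mdeg a == t) && ~~ P (resize m a)].
rewrite /hilb -/S -sum1_card.
rewrite (partition_big (fun a : 'X_{1..m.+2 < t.+1} =>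
  inord (psum a m.+1) : 'I_t.+1) xpredT) //=.
apply: eq_bigr => s _; rewrite sum1_card.
pose g (a : 'X_{1..m.+1}) : 'X_{1..m.+2} :=
  monom m.+2 (fun i => if i < m.+1 then coord a i else t - s).
have gk (a : 'X_{1..m.+1}) k : k <= m.+1 -> psum (g a) k = psum a k.
  move=> hk; apply: eq_psum => i hi.
  by rewrite coord_monom (leq_trans hi hk) (leq_trans hi (leqW hk)).
have gd (a : 'X_{1..m.+1 < s.+1}) : mdeg a = s -> mdeg (g a) = t.
  move=> e; rewrite psum_mdeg psumS gk // -psum_mdeg e coord_monom ltnSn ltnn.
  by rewrite subnKC // -ltnS.
pose G (a : 'X_{1..m.+1 < s.+1}) : 'X_{1..m.+2 < t.+1} := insubd bm0 (g a).
have Gv (a : 'X_{1..m.+1 < s.+1}) : mdeg a = s -> bmnm (G a) = g a.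
  by move=> e; rewrite /G /= val_insubd (gd _ e) ltnSn.
have rg (a : 'X_{1..m.+1}) : resize m (g a) = a.
  apply: coord_inj => i hi.
  by rewrite !coord_monom hi (leq_trans hi).
pose S' := [set a : 'X_{1..m.+1 < s.+1} | (mdeg a == s) && ~~ P a].
rewrite -/S' -(@card_in_imset _ _ G S'); last first.
  move=> a b; rewrite !inE => /andP[/eqP ea _] /andP[/eqP eb _] eG.
  by apply: val_inj; rewrite /= -[bmnm a]rg -[bmnm b]rg -!Gv // eG.
apply: eq_card => c; rewrite unfold_in /= inE.
have lc : psum c m.+1 <= mdeg c by rewrite psum_mdeg psum_le.
apply/andP/imsetP => [[/andP[/eqP e nP] /eqP es]|[a]]; last first.
  rewrite !inE => /andP[/eqP ea nP] ->; rewrite Gv // gd // eqxx rg nP gk //.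
  by rewrite -psum_mdeg ea inord_val.
have es' : psum c m.+1 = s by rewrite -es inordK // ltnS (leq_trans lc) // e.
have ha : mdeg (resize m c) < s.+1 by rewrite psum_mdeg psum_resize // es'.
exists (BMultinom ha); first by rewrite !inE /= nP psum_mdeg psum_resize // es' eqxx.
apply: val_inj; rewrite /= Gv /= ?psum_mdeg ?psum_resize //.
apply: coord_inj => i hi; rewrite coord_monom hi coord_monom.
case: ltnP => // h; have -> : i = m.+1 by apply/eqP; rewrite eqn_leq h -ltnS hi.
by move: e; rewrite psum_mdeg psumS es'; lia.
Qed.

Definition gen_deg (m : nat) (P : pred 'X_{1..m.+1}) (k : nat) : Prop :=
  forall c, P c -> exists b, [/\ P b, (b <= c)%MM & mdeg b <= k].

(** A divisor of [A] in [P] is dominated by [A], so by minimality its degree is not smaller than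
    that of [A]. *)
Lemma gen_deg_dmin m (P : pred 'X_{1..m.+1}) A k :
  gen_deg P k -> dmin P A -> mdeg A <= k.
Proof.
move=> gP dA; have [PA A0 minA] := dA; have [b [Pb bA hb]] := gP _ PA.
have /(_ m (leqnn _)) := minA b Pb (dominated_lem bA).
rewrite -(dmin_mdeg dA) => h; apply: leq_trans h (leq_trans _ hb).
by rewrite psum_mdeg psum_le.
Qed.

(** If the divisor of [c] of degree at most [k] lies in the class of [A], then [c] differs from [A]
    at some [i < m], and [x^A x_i] divides it, one degree above [A]. *)
Lemma gen_deg_removal m (P : pred 'X_{1..m.+1}) A k :
  borel P -> dmin P A -> gen_deg P k -> gen_deg (removal P A) k.+1.
Proof.
move=> bP dA gP c /andP[Pc nc]; have [b [Pb bc hb]] := gP c Pc.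
case: (boolP (same_class A b)) => h; last first.
  by exists b; rewrite /removal Pb h bc ltnW.
have [PA A0 _] := dA; have [dAb dbA] := (same_class_dom A b).1 h.
have [i hi] : exists i : 'I_m, coord A i != coord c i.
  by apply/existsP; rewrite -negb_forall.
have hi1 : i < m.+1 by rewrite ltnW // ltnS.
exists (A + U_(Ordinal hi1))%MM; split.
- rewrite /removal (borel_up bP _ PA) ?lem_addr //=; apply/negP.
  move/same_classP => /(_ i (ltn_ord i)); rewrite coordD coordU eqxx addn1.
  by move/n_Sn.
- have Ac l : coord A l <= coord c l.
    have [hl|hl] := ltnP l m.
      by rewrite (same_classP _ _ h l hl); apply: (lem_coordP _ _ bc).
    move: hl; rewrite leq_eqVlt => /orP[/eqP <-|hl]; first by rewrite A0.
    by rewrite coord_out.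
  apply/lem_coordP => l; rewrite coordD coordU /=.
  by case: eqP => [->|_]; rewrite ?addn0 // addn1 ltn_neqAle hi Ac.
- rewrite mdegD mdeg1 addn1 ltnS (leq_trans _ hb) // (dmin_mdeg dA).
  by rewrite (leq_trans (dAb _ (leqnn _))) // psum_mdeg psum_le.
Qed.

Lemma gen_deg_resize m (P : pred 'X_{1..m.+1}) k :
  gen_deg P k -> gen_deg (fun c : 'X_{1..m.+2} => P (resize m c)) k.
Proof.
move=> gP c /gP[b [Pb bc hb]].
have e : resize m (monom m.+2 (coord b)) = b.
  by apply: coord_inj => i hi; rewrite !coord_monom hi (leq_trans hi).
exists (monom m.+2 (coord b)); rewrite e; split=> //.
  apply/lem_coordP => i; rewrite coord_monom; case: ifP => // hi.
  apply: leq_trans (lem_coordP _ _ bc i) _.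
  by rewrite coord_monom; case: ifP.
rewrite psum_mdeg psumS coord_monom ltnSn [coord b _]coord_out // addn0.
by rewrite -(@psum_resize m m.+1) // e -psum_mdeg.
Qed.

(** * Hilbert functions of lexicographic ideals *)

(** A summand of the Gotzmann form at an integer. For [t < b] the truncated subtraction makes the
    second binomial coefficient vanish. *)
Definition lex_summand (i b t : nat) : nat :=
  'C(t + i, i.+1) - 'C((t - b) + i, i.+1).

Lemma sum_bin i t : \sum_(s < t.+1) 'C(s + i, i.+1) = 'C(t + i.+1, i.+2).
Proof.
elim: t => [|t IH].
  by rewrite big_ord_recl big_ord0 add0n bin_small // add0n bin_small.
by rewrite big_ord_recr /= IH [in RHS]addSn [RHS]binS addSnnS.
Qed.

Lemma sum_bin_sub i b t :
  \sum_(s < t.+1) 'C((s - b) + i, i.+1) = 'C((t - b) + i.+1, i.+2).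
Proof.
elim: t => [|t IH].
  by rewrite big_ord_recl big_ord0 !sub0n !add0n !bin_small.
rewrite big_ord_recr /= IH; have [h|h] := leqP b t.
  by rewrite subSn // [in RHS]addSn [RHS]binS addSnnS.
have [/eqP-> /eqP->] : t.+1 - b == 0 /\ t - b == 0 by rewrite !subn_eq0 h ltnW.
by rewrite ['C(0 + i, _)]bin_small ?addn0.
Qed.

Lemma lex_summandS i b t :
  lex_summand i.+1 b t = \sum_(s < t.+1) lex_summand i b s.
Proof.
rewrite /lex_summand -sum_bin -sum_bin_sub sumnB // => s _.
by apply: leq_bin2l; rewrite leq_add2r leq_subr.
Qed.

Lemma lex_summand0 b t : lex_summand 0 b t = minn b t.
Proof. by rewrite /lex_summand !addn0 !bin1; lia. Qed.

(* The Hilbert function of the lexicographic ideal with Gotzmann numbers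
   b 0 >= ... >= b e. *)
Definition lex_hilb (e : nat) (b : nat -> nat) (t : nat) : nat :=
  minn (b 0) t.+1 + \sum_(i < e) lex_summand i.+1 (b i.+1) t.

(** The shift from [minn b s] to [minn b s.+1] telescopes to the single term [minn b t.+1]. Thus
    summation repeats the leading Gotzmann number. *)
Lemma sum_minn b t :
  \sum_(s < t.+1) minn b s.+1 = minn b t.+1 + lex_summand 1 b t.
Proof.
rewrite lex_summandS [in RHS](eq_bigr (fun s : 'I_t.+1 => minn b s)); last first.
  by move=> s _; rewrite lex_summand0.
elim: t => [|t IH]; first by rewrite !big_ord_recl !big_ord0 /= minn0; lia.
by rewrite big_ord_recr /= IH [in RHS]big_ord_recr /=; lia.
Qed.

Lemma lex_hilb_ext e b c t :
  lex_hilb e.+1 (fun i => if i is i'.+1 then b i' else b 0 + c) t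
  = \sum_(s < t.+1) lex_hilb e b s + (minn (b 0 + c) t.+1 - minn (b 0) t.+1).
Proof.
rewrite /lex_hilb big_split /= sum_minn exchange_big big_ord_recl /=.
rewrite (eq_bigr (fun i : 'I_e => lex_summand i.+2 (b i.+1) t)); last first.
  by move=> i _; rewrite lex_summandS.
rewrite [X in _ = _ + X + _](eq_bigr
  (fun i : 'I_e => lex_summand i.+2 (b i.+1) t)); last first.
  by move=> i _; rewrite lex_summandS.
lia.
Qed.

Lemma lex_hilb_add e b t :
  lex_hilb e (fun i => if i is 0 then (b 0).+1 else b i) t
  = lex_hilb e b t + (b 0 <= t).
Proof. by rewrite /lex_hilb; lia. Qed.

(* Macaulay's lower bound together with Gotzmann's regularity bound. *)
Definition lex_bound (m e : nat) (P : pred 'X_{1..m.+1}) (b : nat -> nat) :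
    Prop :=
  [/\ forall i, i < e -> b i.+1 <= b i,
      forall t, lex_hilb e b t <= hilb P t
    & forall t, b 0 <= t.+1 -> hilb P t = lex_hilb e b t].

(** The Hilbert function gains one from degree [mdeg A] on, the lexicographic one from degree [b 0]
    on. As [mdeg A <= b 0], the lower bound survives, and the two agree again once both have
    jumped. *)
Lemma lex_bound_removal m e (P : pred 'X_{1..m.+1}) A b :
  borel P -> dmin P A -> mdeg A <= b 0 -> lex_bound e P b ->
  lex_bound e (removal P A) (fun i => if i is 0 then (b 0).+1 else b i).
Proof.
move=> bP dA hA [b1 b2 b3]; split.
- by case=> [|i] hi; have := b1 _ hi; lia.
- move=> t; rewrite hilb_removal // lex_hilb_add; have := b2 t.
  by case: (leqP (mdeg A) t); case: (leqP (b 0) t); lia.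
- move=> t; rewrite ltnS => h; rewrite hilb_removal // lex_hilb_add h.
  by rewrite (leq_trans hA h) b3 // ltnW.
Qed.

(** Partial sums accumulate the excess of the Hilbert function over its bound. The excess vanishes
    from degree [b 0 - 1] on, so the sum over [s < b 0] is its total [c], which is absorbed by
    adding [c] to the leading Gotzmann number. *)
Lemma lex_bound_resize m e (P : pred 'X_{1..m.+1}) b :
  lex_bound e P b -> exists c,
    lex_bound e.+1 (fun c : 'X_{1..m.+2} => P (resize m c))
      (fun i => if i is i'.+1 then b i' else b 0 + c).
Proof.
move=> [b1 b2 b3]; pose c := \sum_(s < b 0) (hilb P s - lex_hilb e b s).
have ec t : b 0 <= t.+1 ->
    \sum_(s < t.+1) hilb P s = \sum_(s < t.+1) lex_hilb e b s + c.
  move=> h; rewrite -(subnKC h).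
  elim: (t.+1 - b 0) => [|d IH].
    rewrite addn0 /c -big_split /=; apply: eq_bigr => s _.
    by rewrite subnKC.
  by rewrite addnS !big_ord_recr /= IH b3 ?leqW ?leq_addr // addnAC.
clearbody c; exists c; split.
- by case=> [|i] hi; [rewrite leq_addr | apply: b1].
- move=> t; rewrite hilb_resize lex_hilb_ext.
  have [h|h] := leqP (b 0) t.+1; first by rewrite ec // leq_add2l; lia.
  have : \sum_(s < t.+1) lex_hilb e b s <= \sum_(s < t.+1) hilb P s.
    by apply: leq_sum.
  lia.
- by move=> t h; rewrite hilb_resize lex_hilb_ext ec; lia.
Qed.

Local Open Scope ring_scope.

(** * Gotzmann representations *)

Lemma poly_eventually_eq (p q : {poly rat}) t0 :
  (forall t : nat, (t0 <= t)%N -> p.[t%:R] = q.[t%:R]) -> p = q.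
Proof.
move=> h; apply/eqP; rewrite -subr_eq0; apply: contraT => nz.
pose s := [seq (t0 + i)%:R | i <- iota 0 (size (p - q))] : seq rat.
have us : uniq s.
  rewrite map_inj_uniq ?iota_uniq // => i j /eqP.
  by rewrite eqr_nat eqn_add2l => /eqP.
have rs : all (root (p - q)) s.
  apply/allP => _ /mapP[i _ ->]; apply/rootP.
  by rewrite hornerD hornerN h ?leq_addr ?subrr.
by have := max_poly_roots nz rs us; rewrite size_map size_iota ltnn.
Qed.

(** * The backward difference operator *)

Lemma bdiff_is_linear : linear bdiff.
Proof.
by move=> c p q; rewrite /bdiff comp_polyD comp_polyZ scalerBr opprD addrACA.
Qed.

HB.instance Definition _ :=
  GRing.isLinear.Build rat {poly rat} {poly rat} _ bdiff bdiff_is_linear.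

Lemma horner_bdiff p x : (bdiff p).[x] = p.[x] - p.[x - 1].
Proof. by rewrite /bdiff hornerD hornerN horner_comp !hornerE. Qed.

Lemma bdiff_C c : bdiff c%:P = 0.
Proof. by rewrite /bdiff comp_polyC subrr. Qed.

(** As ['X - ('X - 1) = 1], the difference of the two [n]-th powers is a sum of [n] monic
    polynomials of degree [n.-1]. *)
Lemma size_coef_bdiff_Xn n :
  (size (bdiff 'X^n) <= n)%N /\ (bdiff 'X^n)`_n.-1 = n%:R.
Proof.
rewrite /bdiff comp_Xn_poly subrXX opprB addrCA subrr addr0 mul1r.
have mon i : ('X^(n.-1 - i) * ('X - 1) ^+ i : {poly rat}) \is monic.
  by rewrite rpredM ?rpredX ?monicX // -polyC1 monicXsubC.
have sz (i : 'I_n) : size ('X^(n.-1 - i) * ('X - 1) ^+ i : {poly rat}) = n.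
  rewrite size_monicM ?monicXn ?monic_neq0 ?rpredX //; last first.
    by rewrite -polyC1 monicXsubC.
  by rewrite size_polyXn -polyC1 size_exp_XsubC; have := ltn_ord i; lia.
split.
  by apply: (leq_trans (size_sum _ _ _)); apply/bigmax_leqP => i _; rewrite sz.
rewrite coef_sum (eq_bigr (fun=> 1)) ?sumr_const ?card_ord // => i _.
by have := monicP (mon i); rewrite lead_coefE sz.
Qed.

(** For nonconstant [p] of degree [n.+1], the coefficient of degree [n] comes from the leading term
    alone, with the factor [n.+1], which is nonzero in [rat]. *)
Lemma size_bdiff p : size (bdiff p) = (size p).-1.
Proof.
case sp: (size p) => [|[|n]] /=.
- by move/eqP: sp; rewrite size_poly_eq0 => /eqP ->; rewrite linear0 size_poly0.
- by rewrite (size1_polyC (eq_leq sp)) bdiff_C size_poly0.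
have Sp i : (i <= n.+1)%N -> (size (bdiff 'X^i) <= n.+1)%N.
  by move=> hi; have [h _] := size_coef_bdiff_Xn i; apply: leq_trans h hi.
have ep : bdiff p = \sum_(i < n.+2) p`_i *: bdiff 'X^i.
  rewrite -[p in LHS]coefK poly_def sp linear_sum /=.
  by apply: eq_bigr => i _; rewrite linearZ.
apply/eqP; rewrite eqn_leq; apply/andP; split.
  rewrite ep; apply: (leq_trans (size_sum _ _ _)); apply/bigmax_leqP => i _.
  by apply: leq_trans (size_scale_leq _ _) (Sp _ _); rewrite -ltnS.
suff : (bdiff p)`_n != 0 by apply: contraNT; rewrite -leqNgt => /leq_sizeP ->.
rewrite ep coef_sum big_ord_recr /= coefZ big1 ?add0r => [|i _]; last first.
  rewrite coefZ (leq_sizeP _ _ (leqnn _)) ?mulr0 //.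
  by apply: leq_trans (size_coef_bdiff_Xn i).1 _; rewrite -ltnS; exact: ltn_ord.
have [_ /= ->] := size_coef_bdiff_Xn n.+1.
rewrite mulf_neq0 ?pnatr_eq0 //.
have : lead_coef p != 0 by rewrite lead_coef_eq0 -size_poly_eq0 sp.
by rewrite lead_coefE sp.
Qed.

Lemma horner_binom_poly (q : {poly rat}) k (x : rat) (N : nat) :
  q.[x] = N%:R -> (binom_poly q k).[x] = 'C(N, k)%:R.
Proof.
move=> hq; rewrite /binom_poly hornerZ horner_prod.
have -> : \prod_(l < k) (q - l%:R%:P).[x] = (N ^_ k)%:R.
  elim: k => [|k IH]; first by rewrite big_ord0.
  rewrite big_ord_recr /= IH ffactnSr hornerD hornerN hornerC hq.
  have [h|h] := leqP k N; first by rewrite -natrB // natrM.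
  by rewrite ffact_small // mul0r.
rewrite -bin_ffact natrM mulrC mulfK // pnatr_eq0.
by rewrite -lt0n fact_gt0.
Qed.

Lemma comp_binom_poly (q r : {poly rat}) k :
  binom_poly q k \Po r = binom_poly (q \Po r) k.
Proof.
rewrite /binom_poly comp_polyZ rmorph_prod /=; congr (_ *: _).
by apply: eq_bigr => l _; rewrite comp_polyB comp_polyC.
Qed.

(** Both products on the left share the factors [q - 1 - l] for [l < k]; the remaining factors [q]
    and [q - 1 - k] differ by [k.+1], which cancels in the factorial. *)
Lemma binom_poly_pascal (q : {poly rat}) k :
  binom_poly q k.+1 - binom_poly (q - 1) k.+1 = binom_poly (q - 1) k.
Proof.
rewrite /binom_poly big_ord_recl [X in _ - _ *: X]big_ord_recr /= subr0.
rewrite (eq_bigr (fun l : 'I_k => q - 1 - l%:R%:P)); last first.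
  by move=> l _; rewrite /bump /= add1n -natr1 polyCD polyC1; ring.
set P := \prod_(l < k) _.
have -> : (k.+1)`!%:R^-1 *: (q * P) - (k.+1)`!%:R^-1 *: (P * (q - 1 - k%:R%:P))
   = (k.+1)`!%:R^-1 *: (k.+1%:R *: P).
  rewrite -scalerBr; congr (_ *: _).
  by rewrite -mul_polyC -[k.+1]addn1 natrD polyCD polyC1; ring.
rewrite scalerA factS natrM invfM mulrAC mulVf ?mul1r //.
by rewrite pnatr_eq0.
Qed.

(** The right-hand side of [gotzmann_rep] as a function of [b], so that uniqueness of the
    representation becomes injectivity. *)
Definition gotzmann (d : nat) (b : nat -> int) : {poly rat} :=
  \sum_(i < d.+1)
     (binom_poly ('X + (i%:R)%:P) i.+1
      - binom_poly ('X + ((i%:Z - b i)%:~R)%:P) i.+1).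

Lemma bdiff_binom_poly (c : rat) k :
  bdiff (binom_poly ('X + c%:P) k.+1) = binom_poly ('X + (c - 1)%:P) k.
Proof.
rewrite /bdiff comp_binom_poly comp_polyD comp_polyX comp_polyC.
rewrite (_ : 'X - 1 + c%:P = 'X + c%:P - 1); last by ring.
by rewrite binom_poly_pascal polyCB polyC1 addrA.
Qed.

Lemma gotzmann0 b : gotzmann 0 b = (b 0%N)%:~R%:P.
Proof.
rewrite /gotzmann big_ord_recl big_ord0 /binom_poly !big_ord_recl !big_ord0 /=.
rewrite !subr0 !mulr1 invr1 !scale1r sub0r rmorphN /= polyCN.
by rewrite addr0; ring.
Qed.

Lemma gotzmannSE d b : gotzmann d.+1 b = (b 0%N)%:~R%:P +
  \sum_(i < d.+1)
     (binom_poly ('X + (i.+1%:R)%:P) i.+2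
      - binom_poly ('X + ((i.+1%:Z - b i.+1)%:~R)%:P) i.+2).
Proof.
rewrite -gotzmann0 /gotzmann big_ord_recl [in RHS]big_ord_recl big_ord0.
by congr (_ + _); rewrite [RHS]addr0.
Qed.

(** The summand at [i = 0] is the constant [b 0], which the difference kills; Pascal's rule lowers
    every other summand by one index. *)
Lemma bdiff_gotzmann d b :
  bdiff (gotzmann d.+1 b) = gotzmann d (fun i => b i.+1).
Proof.
rewrite gotzmannSE linearD /= bdiff_C add0r linear_sum.
apply: eq_bigr => i _; rewrite linearB /= !bdiff_binom_poly.
congr (binom_poly ('X + _%:P) _ - binom_poly ('X + _%:P) _).
  by rewrite -natr1 addrK.
by rewrite -[1]/(1%:~R) -rmorphB /=; congr (_%:~R); lia.
Qed.

Lemma iter_bdiff_gotzmann d b j : (j <= d)%N ->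
  iter j bdiff (gotzmann d b) = gotzmann (d - j) (fun i => b (i + j)%N).
Proof.
elim: j => [|j IH] hj.
  by rewrite subn0; apply: eq_bigr => i _; rewrite addn0.
rewrite iterS IH ?(ltnW hj) // -subSS subSn // bdiff_gotzmann.
by apply: eq_bigr => i _; rewrite addnS -addSn.
Qed.

Lemma size_gotzmann d b : 0 < b d -> size (gotzmann d b) = d.+1.
Proof.
elim: d b => [|d IH] b hb.
  by rewrite gotzmann0 size_polyC intr_eq0 gt_eqF.
by have := size_bdiff (gotzmann d.+1 b); rewrite bdiff_gotzmann IH //; lia.
Qed.

(** Taking the difference recovers all numbers but [b 0] by induction; what then remains is the
    constant [b 0]. *)
Lemma gotzmann_inj d b b' : gotzmann d b = gotzmann d b' ->
  forall i, (i <= d)%N -> b i = b' i.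
Proof.
elim: d b b' => [|d IH] b b' e.
  move=> i; rewrite leqn0 => /eqP ->; move: e; rewrite !gotzmann0.
  by move/polyC_inj/eqP; rewrite eqr_int => /eqP.
have e' i : (i <= d)%N -> b i.+1 = b' i.+1.
  by move: i; apply: IH; rewrite -!bdiff_gotzmann e.
case=> [_|i]; last exact: e'.
move: e; rewrite !gotzmannSE.
rewrite [X in _ = _ + X](eq_bigr (fun i : 'I_d.+1 =>
   binom_poly ('X + (i.+1%:R)%:P) i.+2
      - binom_poly ('X + ((i.+1%:Z - b i.+1)%:~R)%:P) i.+2)); last first.
  by move=> i _; rewrite e' // -ltnS.
by move/addIr/polyC_inj/eqP; rewrite eqr_int => /eqP.
Qed.

Lemma horner_gotzmann e (b : nat -> nat) t :
  (forall i, (i < e)%N -> (b i.+1 <= b i)%N) -> (b 0%N <= t)%N ->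
  (gotzmann e (fun i => (b i)%:Z)).[t%:R] = (lex_hilb e b t)%:R.
Proof.
move=> mono b0t.
have bt i : (i <= e)%N -> (b i <= t)%N.
  elim: i => [//|i IH] hi; apply: leq_trans (mono _ hi) (IH _); exact: ltnW.
rewrite /gotzmann horner_sum /lex_hilb big_ord_recl /= natrD natr_sum.
congr (_ + _).
  rewrite (minn_idPl (leqW b0t)) hornerD hornerN.
  rewrite (@horner_binom_poly _ _ _ t); last by rewrite !hornerE.
  rewrite (@horner_binom_poly _ _ _ (t - b 0)%N); last first.
    by rewrite !hornerE natrB //; ring.
  by rewrite !bin1 natrB //; ring.
apply: eq_bigr => i _; have hi := bt i.+1 (ltn_ord i).
rewrite /bump /= add1n.
rewrite hornerD hornerN (@horner_binom_poly _ _ _ (t + i.+1)%N); last first.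
  by rewrite !hornerE natrD.
rewrite (@horner_binom_poly _ _ _ (t - b i.+1 + i.+1)%N); last first.
  by rewrite !hornerE rmorphB /= natrD natrB // !pmulrn; ring.
rewrite natrB // leq_bin2l // leq_add2r leq_subr //.
Qed.

(** * Monomial ideals as sets of exponent vectors *)

Lemma pset_ext (K : fieldType) m (I J : pset K m) : pset_eq I J -> I = J.
Proof.
move=> h; apply: functional_extensionality => f.
exact: propositional_extensionality.
Qed.

(** The span of the monomials with exponents in [P]; it is an ideal when [P] is closed under
    multiples. *)
Definition mideal (K : fieldType) (m : nat) (P : pred 'X_{1..m.+1}) : pset K m :=
  fun f => {subset msupp f <= P}.
Arguments mideal K {m} P f.

Definition upset (m : nat) (P : pred 'X_{1..m.+1}) : Prop :=
  forall a b : 'X_{1..m.+1}, (a <= b)%MM -> P a -> P b.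

Lemma borel_upset m (P : pred 'X_{1..m.+1}) : borel P -> upset P.
Proof. by move=> hP a b; apply: borel_up. Qed.

Section MonomialIdeals.

Variables (K : fieldType) (m : nat).
Implicit Types (P : pred 'X_{1..m.+1}) (f g : {mpoly K[m.+1]}).

Lemma mideal_X P a : mideal K P 'X_[a] <-> P a.
Proof.
split=> [h|h b]; first by apply: (h a); rewrite msuppX inE.
by rewrite msuppX inE => /eqP ->.
Qed.

Lemma mideal0 P : mideal K P 0.
Proof. by move=> a; rewrite msupp0. Qed.

Lemma midealD P f g : mideal K P f -> mideal K P g -> mideal K P (f + g).
Proof.
by move=> hf hg a /msuppD_le; rewrite mem_cat => /orP[/hf|/hg].
Qed.

Lemma midealM P f g : upset P -> mideal K P g -> mideal K P (f * g).
Proof.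
move=> uP hg a /msuppM_le /allpairsP[[b c] /= [_ hc ->]].
by apply: uP (hg _ hc); apply: lem_addl.
Qed.

Lemma mideal_sum P (T : eqType) (s : seq T) (F : T -> {mpoly K[m.+1]}) :
  (forall x, x \in s -> mideal K P (F x)) -> mideal K P (\sum_(x <- s) F x).
Proof.
move=> h; rewrite big_seq; apply: big_ind => [|f g|x]; last exact: h.
- exact: mideal0.
- exact: midealD.
Qed.

Lemma mideal_inj P Q : mideal K P = mideal K Q -> P = Q.
Proof.
move=> e; apply: functional_extensionality => a.
by apply/idP/idP => /(mideal_X _ a).2; [rewrite e | rewrite -e] => /mideal_X.
Qed.

Lemma ideal_gen_mideal (S : pset K m) P : upset P ->
  (forall g, S g -> mideal K P g) ->
  (forall c, P c -> exists u, exists2 g, S g & 'X_[c] = u * g) ->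
  ideal_gen S = mideal K P.
Proof.
move=> uP sub sup; apply: pset_ext => f; split=> [[s [hs ->]]|].
  by apply: mideal_sum => x hx; apply: midealM (sub _ (hs x hx)).
move=> hf; rewrite [f]mpolyE big_seq; apply: big_ind.
- by exists [::]; rewrite big_nil.
- move=> _ _ [s1 [h1 ->]] [s2 [h2 ->]]; exists (s1 ++ s2); rewrite big_cat.
  by split=> // x; rewrite mem_cat => /orP[/h1|/h2].
- move=> c /hf /sup[u [g Sg e]]; exists [:: (f@_c *: u, g)].
  by rewrite big_seq1 e /= scalerAl; split=> // x; rewrite inE => /eqP ->.
Qed.

Lemma mon_gen_mideal (S : 'X_{1..m.+1} -> Prop) P : upset P ->
  (forall a, S a -> P a) ->
  (forall c, P c -> exists2 b : 'X_{1..m.+1}, S b & (b <= c)%MM) ->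
  mon_gen S = mideal K P.
Proof.
move=> uP sub sup; apply: ideal_gen_mideal => // [_ [a Sa ->]|c Pc].
  by apply/mideal_X/sub.
have [b Sb bc] := sup c Pc; exists 'X_[c - b], 'X_[b]; first by exists b.
by rewrite -mpolyXD submK.
Qed.

Lemma whole_mideal : whole K m = mideal K xpredT.
Proof. by apply: pset_ext => f; split. Qed.

Lemma strongly_stable_mideal (I : pset K m) :
  strongly_stable I -> saturated I ->
  exists2 P : pred 'X_{1..m.+1}, borel P & I = mideal K P.
Proof.
move=> [[S /pset_ext eI] st] sat.
pose Q (a : 'X_{1..m.+1}) := dec (exists2 b : 'X_{1..m.+1}, S b & (b <= a)%MM).
have uQ : upset Q.
  move=> a b ab /decP[c Sc ca]; apply/decP; exists c => //.
  exact: lepm_trans ca ab.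
have eQ : I = mideal K Q.
  rewrite eI; apply: mon_gen_mideal => // [a Sa|c /decP //].
  by apply/decP; exists a => //; apply: lepm_refl.
exists Q => //; apply: borel_of_stable => // [a i j Qa aj ij|a Qa].
  by apply/(mideal_X _ _).1; rewrite -eQ; apply: st => //; rewrite eQ; apply/mideal_X.
(* The first power of the maximal ideal suffices: each [x_i x^a] arises from [x_m x^a] by a stable
   move. *)
apply/(mideal_X _ _).1; rewrite -eQ; apply: sat; exists 1%N => u /eqP.
rewrite mdeg_eq1 => /existsP[i /eqP ->]; rewrite -mpolyXD addmC.
have Ia : I 'X_[a + U_(ord_max)] by rewrite eQ; apply/mideal_X.
have [<- //|ne] := eqVneq ord_max i.
have /st : (i < (ord_max : 'I_m.+1))%N.
  by rewrite ltn_neqAle -ltnS ltn_ord andbT eq_sym.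
move=> /(_ _ Ia); rewrite addmK; apply.
by rewrite mnmDE mnm1E eqxx addn1.
Qed.

Lemma mideal_strongly_stable P : borel P ->
  strongly_stable (mideal K P) /\ saturated (mideal K P).
Proof.
move=> bP; have uP := borel_upset bP; split; first split.
- exists P => f; rewrite (@mon_gen_mideal P P) // => c Pc.
  by exists c => //; apply: lepm_refl.
- move=> a i j /mideal_X Pa aj ij; apply/mideal_X.
  exact: borel_stable.
- move=> f [k hk] a ha; apply: (@borel_sat _ _ _ k bP).
  apply: (hk (U_(ord_max) *+ k)%MM); first by rewrite mdegMn mdeg1 mul1n.
  by rewrite mulrC mcoeff_msupp addmC mcoeffMX -mcoeff_msupp.
Qed.

Lemma min_gen_mideal P a : min_gen (mideal K P) a <->
  P a /\ forall b : 'X_{1..m.+1}, (b <= a)%MM -> P b -> b = a.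
Proof.
split=> -[/mideal_X Pa h]; split=> //; try exact/mideal_X.
  by move=> b ba Pb; apply: h => //; apply/mideal_X.
by move=> b ba /mideal_X; apply: h.
Qed.

Lemma min_gen_below P c : P c ->
  exists2 b : 'X_{1..m.+1}, min_gen (mideal K P) b & (b <= c)%MM.
Proof.
have [N] := ubnP (mdeg c); elim: N c => // N IH c lN Pc.
case: (boolP (dec (exists b : 'X_{1..m.+1}, [/\ (b <= c)%MM, P b & b <> c]))).
  case/decP => b [bc Pb ne]; case: (IH b) => // [|b' h1 h2].
    rewrite -(submK bc) mdegD in lN.
    have : (0 < mdeg (c - b)%MM)%N.
      rewrite lt0n mdeg_eq0; apply/eqP => e; apply: ne.
      by rewrite -(submK bc) e add0m.
    lia.
  by exists b' => //; apply: lepm_trans h2 bc.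
move/decP => h; exists c; last exact: lepm_refl.
apply/min_gen_mideal; split=> // b bc Pb.
by apply/eqP/negPn/negP => /eqP ne; apply: h; exists b.
Qed.

Lemma min_gen_last P a : borel P -> min_gen (mideal K P) a -> coord a m = 0%N.
Proof.
move=> bP /min_gen_mideal[Pa h]; rewrite -(h (chop a)) ?coord_chop //.
  exact: chop_le.
by rewrite borel_chop.
Qed.

Lemma dmin_min_gen P A : dmin P A -> min_gen (mideal K P) A.
Proof.
move=> [PA A0 minA]; apply/min_gen_mideal; split=> // b bA Pb.
have bA' := dominated_lem (r := m) bA; have Ab := minA b Pb bA'.
apply: same_class_eq; first by apply/same_class_dom; split.
by apply/eqP; rewrite A0 -leqn0 -A0 (lem_coordP _ _ bA).
Qed.

(* If some u in P lies strictly below a for dominance, then P contains a / x_i for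
   some i, or an element of Right(a), which is then a minimal generator. *)
Lemma expandable_dmin P a : borel P -> expandable (mideal K P) a -> dmin P a.
Proof.
move=> bP [_ mina right_a]; have a0 := min_gen_last bP mina.
have [Pa ma] := (min_gen_mideal _ _).1 mina.
(* Otherwise let [x_i] be the last variable dividing [x^a]. The partial sums of [a] are constant
   beyond [i], so [x^a / x_i] still dominates [u], against the minimality of the generator [a]. *)
have low u : P u -> dominated m u a -> (psum a m <= psum u m)%N.
  move=> Pu ua; rewrite leqNgt; apply/negP => lt_m.
  have [i ai ni] : exists2 i : 'I_m.+1, (0 < a i)%N &
      forall j : 'I_m.+1, (i < j)%N -> a j = 0%N.
    have ex0 : exists i, (i < m.+1)%N && (0 < coord a i)%N.
      case: (boolP [exists i : 'I_m.+1, (0 < coord a i)%N]) => [/existsP[i hi]|].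
        by exists i; rewrite ltn_ord.
      rewrite negb_exists => /forallP h; exfalso; move: lt_m.
      rewrite /psum [X in (_ < X)%N]big1 // => i _; apply/eqP; rewrite -leqn0 leqNgt.
      exact: (h (widen_ord (leqnSn m) i)).
    have ub0 i : (i < m.+1)%N && (0 < coord a i)%N -> (i <= m)%N by case/andP.
    case: (ex_maxnP ex0 ub0) => i /andP[hi ai] maxi.
    exists (Ordinal hi); rewrite -?coord_ord //= => j ij.
    apply/eqP; rewrite -coord_ord -leqn0 leqNgt; apply/negP => aj.
    by have := maxi j; rewrite ltn_ord aj leqNgt ij => /(_ isT).
  have ia : (U_(i) <= a)%MM by rewrite lep1mP -lt0n.
  have e k : psum a k = (psum (a - U_(i))%MM k + (i < k))%N.
    by rewrite -psumU -psumD submK.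
  have const k d : (i < k)%N -> psum a (k + d) = psum a k.
    move=> ik; elim: d => [|d IH]; first by rewrite addn0.
    rewrite addnS psumS IH.
    have [h|h] := ltnP (k + d) m.+1; last by rewrite coord_out ?addn0.
    rewrite -[(k + d)%N]/(nat_of_ord (Ordinal h)) coord_ord ni ?addn0 //=.
    exact: leq_trans ik (leq_addr _ _).
  have : P (a - U_(i))%MM.
    apply: bP Pu _ => k hk; have := ua k hk; rewrite e.
    case: (ltnP i k) => ik; rewrite ?addn0 //.
    by have := psum_le u hk; have := const k (m - k)%N ik; rewrite subnKC // (e k) ik; lia.
  move/(ma _ (lem_subr _ _)) => /mnmP/(_ i).
  by rewrite mnmBE mnm1E eqxx; move: ai; lia.
split=> // u Pu ua.
case: (boolP [exists k : 'I_m.+1, (psum u k < psum a k)%N]); last first.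
  rewrite negb_exists => /forallP h k hk; rewrite leqNgt.
  exact: (h (Ordinal (hk : (k < m.+1)%N))).
case/existsP => -[k hk] /= lk.
have em := low u Pu ua.
have km : (k < m)%N.
  move: hk; rewrite ltnS leq_eqVlt => /orP[/eqP e|//].
  by move: lk; rewrite e ltnNge em.
have ex0 : exists i, (i < k)%N && (0 < coord a i)%N.
  case: (boolP [exists i : 'I_k, (0 < coord a i)%N]) => [/existsP[i hi]|].
    by exists i; rewrite ltn_ord.
  rewrite negb_exists => /forallP h; exfalso; move: lk.
  rewrite /psum [X in (_ < X)%N]big1 // => i _.
  by apply/eqP; rewrite -leqn0 leqNgt.
have ub0 i : (i < k)%N && (0 < coord a i)%N -> (i <= k)%N.
  by case/andP => /ltnW.
(* With [i] the last index below [k] in the support of [a], the strict inequality at [k] already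
   holds at [i.+1]. Replacing [x_i] by [x_(i+1)] lowers only that partial sum, so the result still
   dominates [u]. *)
case: (ex_maxnP ex0 ub0) => i /andP[ik ai] maxi.
have i0 l : (i < l)%N -> (l < k)%N -> coord a l = 0%N.
  move=> il lk'; apply/eqP; rewrite -leqn0 leqNgt; apply/negP => al.
  by have := maxi l; rewrite lk' al leqNgt il => /(_ isT).
have hi : (i < m.+1)%N by lia.
have hi1 : (i.+1 < m.+1)%N by lia.
pose c := (a - U_(Ordinal hi) + U_(Ordinal hi1))%MM.
have ia : (U_(Ordinal hi) <= a)%MM.
  by rewrite lep1mP -lt0n -coord_ord.
have ec l : (psum c l + (l == i.+1) = psum a l)%N.
  rewrite /c psumD psumU /=.
  have : psum a l = (psum (a - U_(Ordinal hi))%MM l + (i < l))%N.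
    by rewrite -[(i < l)%N]/(Ordinal hi < l)%N -psumU -psumD submK.
  by case: (ltngtP l i.+1); lia.
have ci1 : (psum u i.+1 < psum a i.+1)%N.
  suff -> : psum a i.+1 = psum a k by apply: leq_ltn_trans (psum_le _ ik) lk.
  rewrite -(subnKC ik); have : (i.+1 + (k - i.+1) <= k)%N by rewrite subnKC.
  elim: (k - i.+1)%N => [|d IH] h; first by rewrite addn0.
  rewrite addnS [RHS]psumS -IH; last by lia.
  by rewrite i0 ?addn0 //; lia.
have Pc : P c.
  apply: bP Pu _ => l hl; have := ec l; have := ua l hl.
  by case: eqP => [->|]; lia.
have ca : dominated m c a by move=> l _; rewrite -ec leq_addr.
exfalso; apply: (right_a c).
  exists (Ordinal hi), (Ordinal hi1); split=> //=; first by rewrite -coord_ord.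
  by lia.
(* By [low], a divisor of [c] in [P] has the degree of [a], hence that of [c], since none of these
   monomials involves [x_m]. *)
apply/min_gen_mideal; split=> // b bc Pb.
have cm : coord c m = 0%N.
  rewrite /c coordD coordB !coordU /= a0 sub0n.
  by apply/eqP; rewrite eqb0; lia.
have bm : coord b m = 0%N.
  by apply/eqP; rewrite -leqn0 -cm (lem_coordP _ _ bc).
have hb := low b Pb (dominated_trans (dominated_lem bc) ca).
have e : mdeg (c - b)%MM = 0%N.
  have := congr1 (@mdeg _) (submK bc); rewrite mdegD !psum_mdeg !psumS cm bm.
  have := ec m; have -> : (m == i.+1) = false by lia.
  by lia.
by rewrite -(submK bc) (eqP (_ : (c - b)%MM == 0%MM)) ?add0m // -mdeg_eq0 e.
Qed.

Lemma dmin_expandable P a : a <> 0%MM -> dmin P a -> expandable (mideal K P) a.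
Proof.
move=> nz da; split=> //; first exact: dmin_min_gen.
move=> _ [i [j [ai im ej ->]]] /min_gen_mideal[Pc _].
have ij : (i < j)%N by rewrite ej.
have [_ _ mina] := da.
have ia : (U_(i) <= a)%MM by rewrite lep1mP -lt0n.
have e l : (psum (a - U_(i) + U_(j))%MM l + (l == i.+1) = psum a l)%N.
  have : psum a l = (psum (a - U_(i))%MM l + (i < l))%N.
    by rewrite -psumU -psumD submK.
  by rewrite psumD psumU ej; case: (ltngtP l i.+1); lia.
have ca : dominated m (a - U_(i) + U_(j))%MM a.
  by move=> l _; rewrite -e leq_addr.
by have := mina _ Pc ca i.+1 (ltnW im); have := e i.+1; rewrite eqxx; lia.
Qed.

(** The point is that a [c] outside the class of [A] whose minimal generator is [A] is a multiple of
    some [x^A x_i] with [i < m]. For [i >= max_index A] this is a new generator. *)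
Lemma expand_mideal P A : borel P -> dmin P A ->
  expand (mideal K P) A = mideal K (removal P A).
Proof.
move=> bP dA; have bR := borel_removal bP dA.
have [PA A0 _] := dA.
apply: mon_gen_mideal => [|b|c]; first exact: borel_upset.
- case=> [[mb ne]|[k [/andP[_ km] ->]]].
    rewrite /removal ((min_gen_mideal _ _).1 mb).1 /=; apply/negP => h.
    by case: ne; rewrite (same_class_eq h) // A0 (min_gen_last bP mb).
  rewrite /removal (borel_up bP _ PA) ?lem_addr //=; apply/negP.
  move/same_classP => /(_ k km); rewrite coordD coordU eqxx addn1.
  by move/n_Sn.
case/andP => Pc nc; have [b mb bc] := min_gen_below Pc.
have [eb|ne] := eqVneq b A; last by exists b => //; left; split => //; apply/eqP.
subst b; have [i hi] : exists i : 'I_m, coord A i != coord c i.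
  by apply/existsP; rewrite -negb_forall.
have him : (i < m.+1)%N by rewrite ltnW // ltnS.
have hic : (A + U_(Ordinal him) <= c)%MM.
  apply/lem_coordP => l; rewrite coordD coordU /=.
  have Ac := lem_coordP _ _ bc l.
  by case: eqP => [->|_]; rewrite ?addn0 // addn1 ltn_neqAle hi (lem_coordP _ _ bc).
have [ri|ir] := leqP (max_index A) i.
  exists (A + U_(Ordinal him))%MM => //; right; exists (Ordinal him).
  by rewrite /= ri ltn_ord.
have [r Ar er] : exists2 r : 'I_m.+1, (0 < A r)%N & max_index A = r.
  have hA : (0 < #|[pred r : 'I_m.+1 | 0 < A r]|)%N.
    apply/card_gt0P.
    case: (boolP [exists r : 'I_m.+1, (0 < A r)%N]) => [/existsP //|].
    rewrite negb_exists => /forallP h; move: ir; rewrite /max_index big_pred0 //.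
    by move=> r; apply/negbTE.
  have [r Ar er] := eq_bigmax_cond (fun r : 'I_m.+1 => r : nat) hA.
  by exists r.
rewrite er in ir.
(* For [i < r], strong stability puts [x^A x_i / x_r] in the ideal. A minimal generator below it
   divides [c] and differs from [A] at [x_r]. *)
have Pd := borel_stable (i := Ordinal him) bP PA Ar ir.
have [g mg gd] := min_gen_below Pd.
exists g; last first.
  apply: lepm_trans gd (lepm_trans _ hic); apply/mnm_lepP => l.
  by rewrite !mnmDE mnmBE leq_add2r leq_subr.
left; split=> // eg; rewrite eg in gd; have := mnm_lepP gd r.
rewrite mnmDE mnmBE !mnm1E eqxx (_ : (Ordinal him == r) = false); last first.
  by apply/negbTE; rewrite -val_eqE /= ltn_eqF.
by move: Ar; lia.
Qed.

Lemma dmin_predT : dmin (xpredT : pred 'X_{1..m.+1}) 0%MM.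
Proof.
split=> // [|u _ _ k _]; first by rewrite coord0.
by rewrite /psum big1 // => i _; rewrite coord0.
Qed.

Lemma mon_gen_variables :
  mon_gen (fun b : 'X_{1..m.+1} => exists2 k : 'I_m.+1, (k < m)%N & b = U_(k)%MM)
  = mideal K (removal xpredT 0%MM).
Proof.
apply: mon_gen_mideal.
- apply/borel_upset/borel_removal; [by move=> a b | exact: dmin_predT].
- move=> _ [k km ->]; rewrite /removal /=; apply/negP => /same_classP/(_ k km).
  by rewrite coord0 coordU eqxx.
- move=> c; rewrite /removal /= negb_forall => /existsP[i hi].
  have him : (i < m.+1)%N by rewrite ltnW // ltnS.
  exists U_(Ordinal him)%MM; first by exists (Ordinal him); rewrite //= ltn_ord.
  by rewrite lep1mP -coord_ord /=; move: hi; rewrite coord0 eq_sym.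
Qed.

Lemma expansion_removal P A : borel P -> dmin P A ->
  expansion (mideal K P) (mideal K (removal P A)).
Proof.
move=> bP dA; have [PA A0 minA] := dA.
have [e|nz] := eqVneq A 0%MM; last first.
  left; have [h1 h2] := mideal_strongly_stable bP; split=> //.
    move=> h; have P0 : P 0%MM by apply/(mideal_X P 0%MM).1/h.
    move/eqP: nz; apply; have [_ mA] := (min_gen_mideal P A).1 (dmin_min_gen dA).
    by apply/esym/mA => //; apply/mnm_lepP => i; rewrite mnm0E.
  by exists A; [apply: dmin_expandable => //; apply/eqP | rewrite expand_mideal].
right; subst A; have PT : P = xpredT.
  apply: functional_extensionality => c; apply: borel_up PA => //.
  by apply/mnm_lepP => i; rewrite mnm0E.
split; first by rewrite whole_mideal PT.
by rewrite PT mon_gen_variables.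
Qed.

Lemma expansion_inv (I J : pset K m) : expansion I J -> exists P A,
  [/\ borel P, dmin P A, I = mideal K P & J = mideal K (removal P A)].
Proof.
case=> [[st sat _ [a ea /pset_ext eJ]]|[/pset_ext eI /pset_ext eJ]].
  have [P bP eP] := strongly_stable_mideal st sat; exists P, a.
  rewrite eP in ea eJ; have da := expandable_dmin bP ea.
  by split=> //; rewrite eJ expand_mideal.
exists xpredT, 0%MM; rewrite eI eJ whole_mideal mon_gen_variables.
by split=> //; apply: dmin_predT.
Qed.

End MonomialIdeals.

(** * Hilbert functions, extensions and descents of monomial ideals *)

(** The degree [t] part of the ideal is the kernel of reading off the coefficients at the monomials
    outside [P]. This map is onto, so rank-nullity gives the codimension. *)
Lemma hilbert_fun_hilb (K : fieldType) m (P : pred 'X_{1..m.+1}) t :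
  hilbert_fun (mideal K P) t (hilb P t).
Proof.
pose S := [set a : 'X_{1..m.+1 < t.+1} | (mdeg a == t) && ~~ P a].
pose ev (i : 'I_#|S|) : 'X_{1..m.+1} := bmnm (enum_val i).
have evS i : (mdeg (ev i) == t) && ~~ P (ev i).
  by have := enum_valP i; rewrite inE.
pose phi (f : dhomog m.+1 K t) : 'rV[K]_#|S| :=
  \row_i (f : {mpoly K[m.+1]})@_(ev i).
have phi_lin : linear phi.
  by move=> c f g; apply/rowP => i; rewrite !mxE /= mcoeffD mcoeffZ.
pose L := GRing.isLinear.Build K (dhomog m.+1 K t) 'rV[K]_#|S| _ phi phi_lin.
pose phiL : {linear dhomog m.+1 K t -> 'rV[K]_#|S|} := HB.pack phi L.
exists (lker (linfun phiL)); split=> [f|].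
  rewrite memv_ker lfunE /=; split=> [/eqP e a ha|h].
    apply/negPn/negP => nP.
    have da : mdeg a = t := dhomog_mf (dhomog_is_dhomog f) ha.
    have ba : (mdeg a < t.+1)%N by rewrite da.
    have Sa : BMultinom ba \in S by rewrite inE /= da eqxx.
    have := congr1 (fun v : 'rV[K]_#|S| => v 0 (enum_rank_in Sa (BMultinom ba))) e.
    by rewrite !mxE /ev enum_rankK_in //=; apply/eqP; rewrite -mcoeff_msupp.
  apply/eqP/rowP => i; rewrite !mxE; apply/eqP; rewrite mcoeff_eq0.
  by have /andP[_] := evS i; apply: contra => /h.
rewrite -[RHS](limg_ker_dim (linfun phiL)) capfv; congr addn.
suff -> : limg (linfun phiL) = fullv by rewrite dimvf /dim /= mul1n.
apply/vspaceP => v; rewrite memvf; apply/memv_imgP.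
pose F : {mpoly K[m.+1]} := \sum_(i < #|S|) v 0 i *: 'X_[ev i].
have hF : F \is t.-homog.
  apply: rpred_sum => i _; apply: rpredZ; rewrite dhomogX.
  by have /andP[] := evS i.
exists (DHomog hF); rewrite ?memvf // lfunE; apply/rowP => i.
rewrite mxE /= linear_sum /= (bigD1 i) //= big1 ?addr0 => [|j ji].
  by rewrite mcoeffZ mcoeffX eqxx mulr1.
rewrite mcoeffZ mcoeffX (_ : (_ == _) = false) ?mulr0 //.
by apply/negbTE; apply: contra ji => /eqP /val_inj /enum_val_inj ->.
Qed.

Lemma hilbert_fun_inj (K : fieldType) m (I : pset K m) t h h' :
  hilbert_fun I t h -> hilbert_fun I t h' -> h = h'.
Proof.
move=> [U [hU dU]] [V [hV dV]]; suff eUV : U = V.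
  by move: dU; rewrite -dV eUV => /addnI.
by apply/vspaceP => f; apply/idP/idP => [/hU /hV|/hV /hU].
Qed.

Definition hilb_poly (m : nat) (P : pred 'X_{1..m.+1}) (p : {poly rat}) : Prop :=
  exists t0 : nat, forall t, (t0 <= t)%N -> p.[t%:R] = (hilb P t)%:R.

Lemma hilbert_polyE (K : fieldType) m (P : pred 'X_{1..m.+1}) p :
  hilbert_poly (mideal K P) p <-> hilb_poly P p.
Proof.
split=> -[t0 h]; exists t0 => t /h.
  by case=> k hk ->; rewrite (hilbert_fun_inj hk (hilbert_fun_hilb K P t)).
by move=> e; exists (hilb P t) => //; apply: hilbert_fun_hilb.
Qed.

(** * Inclusion into a larger polynomial ring *)

Section Extension.

Variables (K : fieldType) (m m' : nat).
Hypothesis mm' : (m <= m')%N.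

Lemma coord_resize (b : 'X_{1..m.+1}) i : coord (resize m' b) i = coord b i.
Proof.
rewrite coord_monom; case: ltnP => // h.
by rewrite coord_out // (leq_trans _ h).
Qed.

Lemma resize_inj : injective (@resize m' m).
Proof.
by move=> a b e; apply: coord_inj => i _; rewrite -!coord_resize e.
Qed.

Lemma resize_resize_le (c : 'X_{1..m'.+1}) : (resize m' (resize m c) <= c)%MM.
Proof.
by apply/lem_coordP => i; rewrite coord_resize coord_monom; case: ifP.
Qed.

Lemma resizeK (b : 'X_{1..m.+1}) : resize m (resize m' b) = b.
Proof.
by apply: coord_inj => i hi; rewrite coord_monom hi coord_resize.
Qed.

Lemma incl_X (b : 'X_{1..m.+1}) :
  incl m' ('X_[b] : {mpoly K[m.+1]}) = 'X_[resize m' b].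
Proof.
rewrite /incl comp_mpolyX.
under eq_bigr => i _ do rewrite tnth_mktuple.
rewrite mprodXnE; congr 'X_[_]; apply/mnmP => j.
rewrite mnm_sumE -[RHS]coord_ord coord_resize.
have inordE (i : 'I_m.+1) : (inord i : 'I_m'.+1) = i :> nat.
  by rewrite inordK // (leq_trans (ltn_ord i)).
under eq_bigr => i _ do
  rewrite mulmnE mnm1E -val_eqE /= inordE.
have [hj|hj] := ltnP j m.+1; last first.
  rewrite coord_out // big1 // => i _.
  by rewrite ltn_eqF // (leq_trans (ltn_ord i)).
rewrite (bigD1 (Ordinal hj)) //= eqxx mul1n big1 ?addn0 => [|i ij].
  by rewrite -coord_ord.
by rewrite (_ : (_ == _) = false) //; apply: negbTE.
Qed.

Lemma inclE (f : {mpoly K[m.+1]}) :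
  incl m' f = \sum_(b <- msupp f) f@_b *: 'X_[resize m' b].
Proof.
by rewrite /incl comp_mpolyEX; apply: eq_bigr => b _; rewrite -incl_X.
Qed.

Lemma mcoeff_incl (f : {mpoly K[m.+1]}) b : (incl m' f)@_(resize m' b) = f@_b.
Proof.
rewrite inclE [in RHS](mpolyE f) !linear_sum /=; apply: eq_bigr => c _.
by rewrite !mcoeffZ !mcoeffX (inj_eq resize_inj).
Qed.

Lemma extension_mideal (Q : pred 'X_{1..m.+1}) : upset Q ->
  extension m' (mideal K Q) = mideal K (fun c => Q (resize m c)).
Proof.
move=> uQ; apply: ideal_gen_mideal => [a b ab|_ [f Qf ->]|c Qc].
- apply: uQ; apply/lem_coordP => i; rewrite !coord_monom; case: ifP => // _.
  exact: lem_coordP _ _ ab i.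
- rewrite inclE; apply: mideal_sum => b /Qf Qb; rewrite -mul_mpolyC.
  apply: midealM; last by apply/mideal_X; rewrite resizeK.
  move=> a c ac; apply: uQ; apply/lem_coordP => i; rewrite !coord_monom.
  case: ifP => // _; exact: lem_coordP _ _ ac i.
exists 'X_[c - resize m' (resize m c)], 'X_[resize m' (resize m c)].
  by exists 'X_[resize m c]; [apply/mideal_X | rewrite incl_X].
by rewrite -mpolyXD submK // resize_resize_le.
Qed.

End Extension.

Lemma descent_mideal (K : fieldType) n m (P : pred 'X_{1..n.+1}) :
  (m <= n)%N -> borel P -> descent m (mideal K P) = mideal K (trace m m P).
Proof.
move=> mn bP; apply: ideal_gen_mideal => [|g [a mina eg] b bg|c].
- exact/borel_upset/borel_trace.
- have : resize n b \in msupp (incl n g).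
    by rewrite mcoeff_msupp mcoeff_incl // -mcoeff_msupp.
  rewrite eg msuppX inE => /eqP e; apply/decP; exists a.
    by case: mina => /mideal_X.
  move=> k hk; rewrite (@eq_psum _ _ a b k) // => i hi.
  have im := leq_trans hi hk.
  have hin : (i < n.+1)%N by rewrite ltnS ltnW // (leq_trans im).
  rewrite -(coord_resize mn b i) e -[i]/(nat_of_ord (Ordinal hin)) !coord_ord mnmE.
  by rewrite /= leqNgt im.
case/decP => a Pa ac.
(* The exponent [mdeg a] at [x_m] makes [a0] dominate [a] beyond index [m], whence [a0] is in [P].
   Setting [x_m = ... = x_(n-1) = 1] in a minimal generator dividing it leaves a divisor of [c]. *)
pose a0 : 'X_{1..n.+1} := monom n.+1 (fun i => if (i < m)%N then coord c i
  else if i == m then mdeg a else 0%N).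
have a0k k : (k <= m)%N -> psum a0 k = psum c k.
  move=> hk; apply: eq_psum => i hi; have im := leq_trans hi hk.
  by rewrite coord_monom im ltnS ltnW // (leq_trans im).
have Pa0 : P a0.
  apply: bP Pa _ => k hk; have [km|km] := leqP k m; first by rewrite a0k ?ac.
  apply: leq_trans (psum_le a0 km); rewrite psumS coord_monom ltnS mn ltnn eqxx.
  by apply: leq_trans (leq_addl _ _); rewrite psum_mdeg psum_le // leqW.
have [a' ma a'0] := min_gen_below K Pa0; have an := min_gen_last bP ma.
pose b : 'X_{1..m.+1} :=
  monom m.+1 (fun i => if (i < m)%N then coord a' i else 0%N).
have bc : (b <= c)%MM.
  apply/lem_coordP => i; rewrite coord_monom; case: ifP => // _.
  case: ifP => // im; apply: leq_trans (lem_coordP _ _ a'0 i) _.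
  by rewrite coord_monom im; case: ifP.
exists 'X_[c - b], 'X_[b]; last by rewrite -mpolyXD submK.
exists a' => //; rewrite incl_X //; congr 'X_[_]; apply/mnmP => i.
rewrite -coord_ord coord_resize // coord_monom mnmE -coord_ord.
case: (ltnP i m) => im /=; first by rewrite ltnS ltnW.
rewrite if_same; case: (ltnP i n) => // ni.
by have -> : nat_of_ord i = n; [apply/eqP; rewrite eqn_leq ni -ltnS ltn_ord | rewrite an].
Qed.

(** * Sequences of expansions *)

Lemma borel_resize m (P : pred 'X_{1..m.+1}) :
  borel P -> borel (fun c : 'X_{1..m.+2} => P (resize m c)).
Proof.
move=> bP a b Pa ab; apply: bP Pa _ => k hk.
by rewrite !psum_resize ?ab // leqW.
Qed.

Lemma removals_hilb m (E D : pred 'X_{1..m.+1}) s : borel E -> removals E s D ->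
  exists t0, forall t, (t0 <= t)%N -> hilb D t = (hilb E t + size s)%N.
Proof.
elim: s E => [|A s IH] E bE /= => [h|[dA /(IH _ (borel_removal bE dA))[t0 ht]]].
  by exists 0%N => t _; rewrite addn0 (eq_hilb _ h).
exists (maxn t0 (mdeg A)) => t; rewrite geq_max => /andP[h1 h2].
by rewrite ht // hilb_removal // h2 -addnA add1n.
Qed.

(** Each removal raises both the generation degree and [b 0] by one, so the inequality [k <= b 0],
    which bounds the degree of the next removed monomial, persists. *)
Lemma removals_lex_bound m e (E D : pred 'X_{1..m.+1}) s k b :
  borel E -> removals E s D -> gen_deg E k -> (k <= b 0)%N -> lex_bound e E b ->
  exists b', [/\ gen_deg D (k + size s), (k + size s <= b' 0)%N,
    lex_bound e D b', b' 0%N = (b 0 + size s)%N & forall i, b' i.+1 = b i.+1].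
Proof.
elim: s E k b => [|A s IH] E k b bE /=.
  move=> h gE kb lE; exists b; rewrite !addn0.
  by have <- : E = D by apply: functional_extensionality.
move=> [dA hs] gE kb lE; have hA := leq_trans (gen_deg_dmin gE dA) kb.
have [] := IH _ k.+1 _ (borel_removal bE dA) hs (gen_deg_removal bE dA gE) _
  (lex_bound_removal bE dA hA lE) => // b' [h1 h2 h3 h4 h5].
by exists b'; rewrite addnS -addSn; split=> //; rewrite h4 addnS addSn.
Qed.

(** For [m = n - j], the exponents of [I^(j+1) R^(j)], with the convention that this is the whole
    ring at the starting index [m0]. *)
Definition start_set (n m0 m : nat) (P : pred 'X_{1..n.+1}) :
    pred 'X_{1..m.+1} := if m == m0 then xpredT else trace m.-1 m P.
Arguments start_set {n} m0 m P c.

Section Sequences.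

Variable K : fieldType.

Lemma removals_expansions m (I : pset K m) (E D : pred 'X_{1..m.+1}) s k :
  borel E -> removals E s D -> expansions I k (mideal K E) ->
  expansions I (k + size s) (mideal K D).
Proof.
elim: s E k => [|A s IH] E k bE /= => [h|[dA hs]] eE.
  by rewrite addn0; have <- : E = D by apply: functional_extensionality.
rewrite addnS -addSn; apply: IH hs _; first exact: borel_removal.
exact: ExpansionsS eE (expansion_removal K bE dA).
Qed.

Lemma removals_expansion_seq m0 m (E D : pred 'X_{1..m.+1}) s k :
  borel E -> removals E s D -> expansion_seq m0 k (mideal K E) ->
  expansion_seq m0 (k + size s) (mideal K D).
Proof.
elim: s E k => [|A s IH] E k bE /= => [h|[dA hs]] eE.
  by rewrite addn0; have <- : E = D by apply: functional_extensionality.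
rewrite addnS -addSn; apply: IH hs _; first exact: borel_removal.
exact: ExpSeqExpand eE (expansion_removal K bE dA).
Qed.

(** The number of expansions can be read off from Hilbert functions, hence it is the same for all
    sequences between two given ideals. *)
Lemma expansions_hilb m (E : pred 'X_{1..m.+1}) k (J : pset K m) :
  borel E -> expansions (mideal K E) k J ->
  exists D : pred 'X_{1..m.+1}, J = mideal K D /\
    exists t0, forall t, (t0 <= t)%N -> hilb D t = (hilb E t + k)%N.
Proof.
move=> bE; elim=> [{}J /pset_ext ->|{}k {}J L _ [D [eJ [t0 ht]]] eL].
  by exists E; split=> //; exists 0%N => t _; rewrite addn0.
have [P [A [bP dA eP ->]]] := expansion_inv eL.
have eDP : D = P by apply: (@mideal_inj K); rewrite -eJ.
subst P; exists (removal D A); split=> //; exists (maxn t0 (mdeg A)) => t.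
rewrite geq_max => /andP[h1 h2].
by rewrite hilb_removal // h2 ht // addnS addn1.
Qed.

Definition seq_state (m e k : nat) (P : pred 'X_{1..m.+1}) (b : nat -> nat) :
    Prop :=
  [/\ borel P, gen_deg P k, (k <= b 0)%N & lex_bound e P b].

Lemma seq_state_predT m :
  seq_state 0 0 (xpredT : pred 'X_{1..m.+1}) (fun=> 0%N).
Proof.
split=> //.
  by move=> c _; exists 0%MM; split=> //; [apply/mnm_lepP => i; rewrite mnm0E | rewrite mdeg0].
by split=> // t; rewrite /lex_hilb big_ord0 ?hilb_predT.
Qed.

Lemma seq_state_resize m e k (P : pred 'X_{1..m.+1}) b :
  seq_state e k P b -> exists c,
    seq_state e.+1 k (fun c : 'X_{1..m.+2} => P (resize m c))
      (fun i => if i is i'.+1 then b i' else b 0 + c)%N.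
Proof.
move=> [bP gP kb /lex_bound_resize[c lc]]; exists c; split=> //.
- exact: borel_resize.
- exact: gen_deg_resize.
- exact: leq_trans kb (leq_addr _ _).
Qed.

(** Stated for arbitrary sequences, since the bound on the total number concerns every sequence that
    reaches the ideal. *)
Lemma expansion_seq_state m0 m k (I : pset K m) : expansion_seq m0 k I ->
  (m0 <= m)%N /\ exists P b, I = mideal K P /\ seq_state (m - m0) k P b.
Proof.
elim=> {m k I} [I /pset_ext ->|m k I J _ [mm [P [b [eI [bP gP kb lP]]]]] eJ|].
- split=> //; exists xpredT, (fun=> 0%N); rewrite whole_mideal subnn.
  by split=> //; apply: seq_state_predT.
- have [Q [A [bQ dA eQ ->]]] := expansion_inv eJ.
  have ePQ : P = Q by apply: (@mideal_inj K); rewrite -eI.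
  subst Q; split=> //; exists (removal P A).
  exists (fun i => if i is 0 then (b 0).+1 else b i); split=> //; split=> //.
  + exact: borel_removal.
  + exact: gen_deg_removal.
  + by apply: lex_bound_removal => //; apply: leq_trans (gen_deg_dmin gP dA) kb.
- move=> m k I J _ [mm [P [b [-> sP]]]] /pset_ext ->.
  split; first exact: leqW.
  have [c sc] := seq_state_resize sP.
  exists (fun c : 'X_{1..m.+2} => P (resize m c)); eexists.
  split; last by rewrite subSn //; exact: sc.
  by apply: extension_mideal => //; apply: borel_upset; case: sP.
Qed.

(** * The tower of descents, starting from the least index with a proper trace *)

Section Tower.

Variables (n m0 : nat) (P : pred 'X_{1..n.+1}).
Hypotheses (m0P : ~~ trace m0 m0 P 0%MM).
Hypothesis min_m0 : forall m, (m < m0)%N -> trace m m P 0%MM.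

(** Positivity of the last number fixes the degree of the Hilbert polynomial. The last clause
    becomes the bound by [a_j] once the numbers are identified with those of the Gotzmann
    representation. *)
Definition stage (m : nat) : Prop := exists k b s,
  [/\ expansion_seq m0 k (mideal K (trace m m P)),
      seq_state (m - m0) k (trace m m P) b,
      (0 < b (m - m0))%N,
      removals (start_set m0 m P) s (trace m m P)
    & (size s <= if m == m0 then b 0 else b 0 - b 1)%N].

Lemma stage_first : stage m0.
Proof.
have bT : borel (xpredT : pred 'X_{1..m0.+1}) by [].
have [B hB] : exists B, forall c : 'X_{1..m0.+1},
    xpredT c -> (B <= psum c m0)%N -> trace m0 m0 P c.
  (* For [m0 = 0] the partial sum is empty and [B = 1] makes the condition void. Otherwise
     minimality of [m0] makes the trace with [r = m0.-1] everything, and [trace_finite] applies. *)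
  case: (posnP m0) => [e|m0_gt0].
    exists 1%N => c _; rewrite ltnNge; move/negP; case.
    by rewrite -(psum0 c) psum_le // e.
  have [B hB] := trace_finite m0 P; exists B => c _; apply: hB.
  have /min_m0/decP[a Pa a0] : (m0.-1 < m0)%N by rewrite prednK.
  apply/decP; exists a => // k hk; apply: leq_trans (a0 k hk) _.
  by rewrite /psum big1 // => i _; rewrite coord0.
have [s hs] := removals_exist bT (borel_trace (P := P) (leqnn m0)) (fun _ _ => isT) hB.
have [_ gT kT lT] := seq_state_predT m0.
have [b [h1 h2 h3 h4 _]] := removals_lex_bound bT hs gT kT lT.
exists (0 + size s)%N, b, s; rewrite subnn eqxx h4 /start_set eqxx; split=> //.
- apply: removals_expansion_seq bT hs _; rewrite -whole_mideal.
  exact: ExpSeqStart.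
- by split=> //; apply: borel_trace.
(* The trace at [m0] is proper, so at least one removal takes place. *)
- case: s hs {h1 h2 h4} => //= h; case/negP: m0P; rewrite -h //.
Qed.

Lemma stage_next m : (m0 <= m)%N -> (m < n)%N -> stage m -> stage m.+1.
Proof.
move=> m0m mn [k [b [s [es st b0 _ _]]]].
have e0 : (m.+1 == m0) = false by rewrite gtn_eqF // ltnS.
have eE : start_set m0 m.+1 P = (fun c : 'X_{1..m.+2} => trace m m P (resize m c)).
  apply: functional_extensionality => c.
  by rewrite /start_set e0 /= trace_resize.
have bE : borel (start_set m0 m.+1 P) by rewrite /start_set e0; apply: borel_trace.
have bD := borel_trace (P := P) (leqnn m.+1).
have DE c : trace m.+1 m.+1 P c -> start_set m0 m.+1 P c.
  rewrite /start_set e0 => /decP[a Pa ac]; apply/decP; exists a => // l hl.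
  by apply: ac; apply: leqW.
have [B hB] : exists B, forall c, start_set m0 m.+1 P c -> (B <= psum c m.+1)%N ->
    trace m.+1 m.+1 P c by rewrite /start_set e0; apply: trace_finite.
have [s' hs'] := removals_exist bE bD DE hB.
have [c sc] := seq_state_resize st; rewrite -eE in sc.
have [_ gE kE lE] := sc.
have [b' [h1 h2 h3 h4 h5]] := removals_lex_bound bE hs' gE kE lE.
exists (k + size s')%N, b', s'; rewrite subSn // h4 h5 e0; split=> //.
- apply: removals_expansion_seq bE hs' _; apply: ExpSeqExtend es _.
  rewrite eE extension_mideal //.
  exact/borel_upset/borel_trace.
(* The difference [b' 0 - b' 1] equals [c + size s'], where [c] is the excess created by the
   extension. *)
- by rewrite h5 -addnA addKn leq_addl.
Qed.

Lemma stage_all m : (m0 <= m)%N -> (m <= n)%N -> stage m.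
Proof.
elim: m => [|m IH]; first by rewrite leqn0 => /eqP <- _; apply: stage_first.
rewrite leq_eqVlt => /orP[/eqP <- _|]; first exact: stage_first.
by rewrite ltnS => h1 h2; apply: stage_next => //; apply: IH => //; apply: ltnW.
Qed.

End Tower.

End Sequences.

Lemma lex_bound_gotzmann m e (P : pred 'X_{1..m.+1}) b p :
  lex_bound e P b -> hilb_poly P p -> p = gotzmann e (fun i => (b i)%:Z).
Proof.
move=> [b1 _ b3] [t0 ht]; apply: (@poly_eventually_eq _ _ (maxn t0 (b 0%N))) => t.
rewrite geq_max => /andP[h1 h2].
by rewrite ht // horner_gotzmann // b3 // leqW.
Qed.

(** Removals change the Hilbert polynomial by a constant, which the difference kills; the difference
    of the partial sums of [hilb P] gives back [hilb P]. *)
Lemma bdiff_hilb_poly m (P : pred 'X_{1..m.+1}) (D : pred 'X_{1..m.+2}) s p :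
  borel P -> removals (fun c : 'X_{1..m.+2} => P (resize m c)) s D ->
  hilb_poly D p -> hilb_poly P (bdiff p).
Proof.
move=> bP /(removals_hilb (borel_resize bP))[t0 h0] [t1 h1].
exists (maxn t0 t1).+1; case=> // t; rewrite ltnS geq_max => /andP[le0 le1].
rewrite horner_bdiff -[t.+1%:R - 1](_ : t%:R = _); last by rewrite -natr1 addrK.
rewrite !h1 ?leqW // !h0 ?leqW // !hilb_resize big_ord_recr /=.
by rewrite -natrB ?leq_add2r ?leq_addr //; congr _%:R; lia.
Qed.

Lemma descent_ext_mideal (K : fieldType) n m0 d j (P : pred 'X_{1..n.+1}) :
  borel P -> (m0 + d = n)%N -> (j <= d)%N ->
  descent_ext d j (mideal K P) = mideal K (start_set m0 (n - j)%N P).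
Proof.
move=> bP e jd; rewrite /descent_ext /start_set.
have -> : (n - j == m0)%N = (j == d) by apply/eqP/eqP; lia.
case: eqP => [_|ne]; first exact: whole_mideal.
rewrite descent_mideal ?leq_subr // extension_mideal; last 2 first.
- by rewrite leq_sub2l.
- exact/borel_upset/borel_trace.
congr mideal; apply: functional_extensionality => c.
by rewrite trace_resize ?leqnSn // subnS.
Qed.

Theorem theorem4p4 (K : fieldType) (n d : nat) (I : pset K n) (p : {poly rat})
    (hn : (2 <= n)%N) (hproper : proper_pset I) (hss : strongly_stable I)
    (hsat : saturated I) (hp : hilbert_poly I p) (hd : size p = d.+1) :
  [/\ exists k : nat, expansion_seq (n - d) k I,
      forall j : nat, (j <= d)%N ->
        exists q : {poly rat}, hilbert_poly (descent_ext d j I) q /\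
        exists N : nat,
          [/\ expansions (descent_ext d j I) N (descent (n - j) I),
              forall k : nat,
                expansions (descent_ext d j I) k (descent (n - j) I) -> k = N,
              (N%:R)%:P = iter j bdiff p - q
            & forall b : nat -> int, gotzmann_rep d b p ->
                N%:Z <= gotzmann_a d b j]
    & forall b : nat -> int, gotzmann_rep d b p ->
        forall k : nat, expansion_seq (n - d) k I -> k%:Z <= b 0%N].
Proof.
have [P bP eI] := strongly_stable_mideal hss hsat; subst I.
move/hilbert_polyE: hp => hpP.
have nP0 : ~~ P 0%MM.
  apply/negP => P0; apply: hproper => f; split=> // _ a _.
  by apply: borel_up P0 => //; apply/mnm_lepP => i; rewrite mnm0E.
have ex0 : exists m, ~~ trace m m P 0%MM by exists n; rewrite trace_id.
case: (ex_minnP ex0) => m0 m0P m0min.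
have m0n : (m0 <= n)%N by apply: m0min; rewrite trace_id.
have min_m0 m : (m < m0)%N -> trace m m P 0%MM.
  by rewrite ltnNge => h; apply/negPn; apply: contra h => /m0min.
have st m := stage_all K m0P min_m0 (m := m).
have eP : trace n n P = P by apply: functional_extensionality => c; rewrite trace_id.
have [k0 [b0 [s0 [seq0 [_ _ _ lex0] b0_gt0 _ _]]]] := st n m0n (leqnn n).
rewrite eP in seq0 lex0.
(* A Gotzmann form with positive last number has degree equal to its last index, here [n - m0]. *)
have ed : (m0 + d = n)%N.
  have := lex_bound_gotzmann lex0 hpP => ep; move: hd; rewrite ep.
  by rewrite size_gotzmann // => -[<-]; rewrite subnKC.
have hpoly j : (j <= d)%N -> hilb_poly (trace (n - j)%N (n - j)%N P) (iter j bdiff p).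
  elim: j => [_|j IH hj]; first by move: (n - 0)%N (subn0 n) => n' ->; rewrite eP.
  have := IH (ltnW hj); rewrite iterS.
  have -> : (n - j = (n - j.+1).+1)%N by lia.
  set m := (n - j.+1)%N.
  have m1 : (m0 <= m)%N by rewrite /m; lia.
  have m2 : (m.+1 <= n)%N by rewrite /m; lia.
  have [k [b [s [_ _ _ hs _]]]] := st m.+1 (leqW m1) m2.
  apply: (@bdiff_hilb_poly _ _ _ s); first exact: borel_trace.
  suff <- : start_set m0 m.+1 P = (fun c => trace m m P (resize m c)) by [].
  apply: functional_extensionality => c.
  by rewrite /start_set gtn_eqF ?ltnS // trace_resize.
have end_ring : (n - d = m0)%N by lia.
split.
- by exists k0; rewrite end_ring.
- move=> j jd; have := hpoly j jd; rewrite (descent_ext_mideal _ bP ed jd).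
  rewrite descent_mideal ?leq_subr //.
  have m1 : (m0 <= n - j)%N by lia.
  have [k [b [s [_ [bD _ _ lexD] _ hs hN]]]] := st _ m1 (leq_subr j n).
  have bE : borel (start_set m0 (n - j)%N P).
    by rewrite /start_set; case: eqP => // _; apply: borel_trace; apply: leq_pred.
  have [t0 h0] := removals_hilb bE hs => hq; have [t1 h1] := hq.
  exists (iter j bdiff p - (size s)%:R%:P); split.
    apply/hilbert_polyE; exists (maxn t0 t1) => t.
    rewrite geq_max => /andP[le0 le1].
    by rewrite !hornerE h1 // h0 // natrD addrK.
  exists (size s); split.
  + by apply: (@removals_expansions _ _ _ _ _ _ 0%N bE hs); apply: Expansions0.
  + move=> k' /(expansions_hilb bE)[D [/mideal_inj eD [t2 h2]]].
    subst D; have := h2 (maxn t0 t2); rewrite h0 ?leq_maxl // => /(_ (leq_maxr _ _)).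
    by move/addnI.
  + by rewrite opprB addrC subrK.
  (* The numbers kept at this stage represent the [j]-th difference of [p], so by uniqueness they
     are [bz j], [bz j.+1], and so on. *)
  + move=> bz [_ _ ep]; have {}ep : p = gotzmann d bz := ep.
    have := lex_bound_gotzmann lexD hq.
    rewrite ep iter_bdiff_gotzmann // (_ : n - j - m0 = d - j)%N; last by lia.
    move=> eb; have eb' i := gotzmann_inj eb (i := i).
    have e0 : bz j = (b 0%N)%:Z by have := eb' 0%N (leq0n _); rewrite add0n.
    move: hN; rewrite /gotzmann_a.
    have -> : (n - j == m0)%N = (j == d) by apply/eqP/eqP; lia.
    case: eqP => [<-|ne] hN; first by rewrite e0 lez_nat.
    have e1 : bz j.+1 = (b 1%N)%:Z.
      by have := eb' 1%N; rewrite add1n; apply; lia.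
    rewrite e0 e1; have [b1 _ _] := lexD.
    by have := b1 0%N; lia.
- move=> bz [_ _ ep] k hk; have {}ep : p = gotzmann d bz := ep.
  have [_ [Q [b [/mideal_inj eQ [_ _ kb lexQ]]]]] := expansion_seq_state hk.
  subst Q; have := lex_bound_gotzmann lexQ hpP.
  rewrite ep (_ : n - (n - d) = d)%N; last by lia.
  by move=> /gotzmann_inj/(_ 0%N isT) ->; rewrite lez_nat.
Qed.
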